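(* Let $\mathbb{L}$ be a complete, algebraically closed non-Archimedean field of characteristic $0$, and let $\phi$ be a rational map of degree $\geq 2$ defined over $\mathbb{L}$ having good reduction. Then the fixed point locus $\{\zeta \in \mathbb{P}^1_{an} : \phi(\zeta)=\zeta\}$ of $\phi$ in the Berkovich projective line $\mathbb{P}^1_{an}$ over $\mathbb{L}$ is connected if and only if the reduction $\tilde\phi$ of $\phi$ has no fixed critical point in $\mathbb{P}^1(\tilde{\mathbb{L}})$.
   Context: $\mathcal{O}_{\mathbb{L}}=\{|x|\le 1\}$ is the valuation ring, $m_{\mathbb{L}}$ its maximal ideal and $\tilde{\mathbb{L}}=\mathcal{O}_{\mathbb{L}}/m_{\mathbb{L}}$ the residue field. A normalized form of $\phi$ is a representation $\phi=F/G$ with $F,G$ coprime and all coefficients in $\mathcal{O}_{\mathbb{L}}$, not all in $m_{\mathbb{L}}$; reducing the coefficients modulo $m_{\mathbb{L}}$ and cancelling common factors gives the reduction $\tilde\phi$, a rational map over $\tilde{\mathbb{L}}$. $\phi$ has good reduction if $\deg\tilde\phi=\deg\phi$. A critical point of $\tilde\phi$ is a point of $\mathbb{P}^1(\tilde{\mathbb{L}})$ at which $\tilde\phi$ has multiplicity (local degree) at least $2$. The action of $\phi$ on $\mathbb{P}^1(\mathbb{L})$ extends uniquely and continuously to the Berkovich projective line $\mathbb{P}^1_{an}$ (with its weak/Berkovich topology), and connectedness is with respect to this topology. *)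

(* Defs.v *)
From HB Require Import structures.
From mathcomp Require Import all_boot all_order all_algebra.
From mathcomp Require Import reals.
Set Implicit Arguments. Unset Strict Implicit. Unset Printing Implicit Defensive.
Import Order.TTheory GRing.Theory Num.Theory.
Local Open Scope ring_scope.

Definition nonarch_abs (R : realType) (L : fieldType) (absv : L -> R) : Prop :=
  [/\ forall x, 0 <= absv x,
      forall x, absv x = 0 <-> x = 0,
      forall x y, absv (x * y) = absv x * absv y,
      forall x y, absv (x + y) <= Num.max (absv x) (absv y)
    & exists x, absv x != 0 /\ absv x != 1].

Definition abs_complete (R : realType) (L : fieldType) (absv : L -> R) : Prop :=
  forall u : nat -> L,
    (forall e : R, 0 < e -> exists N, forall m n, (N <= m)%N -> (N <= n)%N ->
        absv (u m - u n) < e) ->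
    exists l, forall e : R, 0 < e -> exists N, forall n, (N <= n)%N ->
        absv (u n - l) < e.

Definition char0 (L : fieldType) : Prop := forall n : nat, (0 < n)%N -> n%:R != 0 :> L.

(* k together with red : L -> k is the residue field O_L / m_L with its
   reduction map: red restricted to O_L = {|x| <= 1} is a surjective ring
   morphism with kernel m_L = {|x| < 1}.  This determines k up to unique
   isomorphism compatible with red. *)
Definition residue_field (R : realType) (L : fieldType) (absv : L -> R)
    (k : fieldType) (red : L -> k) : Prop :=
  [/\ forall x y, absv x <= 1 -> absv y <= 1 -> red (x + y) = red x + red y,
      forall x y, absv x <= 1 -> absv y <= 1 -> red (x * y) = red x * red y,
      red 1 = 1,
      forall x, absv x <= 1 -> (red x = 0 <-> absv x < 1)
    & forall a : k, exists x, absv x <= 1 /\ red x = a].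

(* degree of the rational map F/G, for F, G coprime *)
Definition rdeg (K : fieldType) (F G : {poly K}) : nat := (maxn (size F) (size G)).-1.

Definition normalized (R : realType) (L : fieldType) (absv : L -> R) (F G : {poly L}) :=
  [/\ forall i, absv F`_i <= 1, forall i, absv G`_i <= 1
    & exists i, absv F`_i = 1 \/ absv G`_i = 1].

Definition redF (L k : fieldType) (red : L -> k) (F G : {poly L}) : {poly k} :=
  map_poly red F %/ gcdp (map_poly red F) (map_poly red G).
Definition redG (L k : fieldType) (red : L -> k) (F G : {poly L}) : {poly k} :=
  map_poly red G %/ gcdp (map_poly red F) (map_poly red G).

Definition good_reduction (L k : fieldType) (red : L -> k) (F G : {poly L}) : Prop :=
  rdeg (redF red F G) (redG red F G) = rdeg F G.

Inductive P1pt (K : Type) := Fin of K | Inf.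
Arguments Inf {K}.

(* Y^d F(X/Y) dehomogenized at the other chart: z^d F(1/z) *)
Definition homrev (K : fieldType) (d : nat) (p : {poly K}) : {poly K} :=
  \poly_(i < d.+1) p`_(d - i).

Definition rat_map (K : fieldType) (d : nat) (F G : {poly K}) (x : P1pt K) : P1pt K :=
  match x with
  | Fin a => if G.[a] != 0 then Fin (F.[a] / G.[a]) else Inf
  | Inf => let F' := homrev d F in let G' := homrev d G in
           if G'.[0] != 0 then Fin (F'.[0] / G'.[0]) else Inf
  end.

Definition locdeg (K : fieldType) (d : nat) (F G : {poly K}) (x : P1pt K) : nat :=
  let loc (F G : {poly K}) (a : K) :=
      if G.[a] != 0 then mup a (F - (F.[a] / G.[a])%:P * G) else mup a G in
  match x with
  | Fin a => loc F G a
  | Inf => loc (homrev d F) (homrev d G) 0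
  end.

Definition critical (K : fieldType) (d : nat) (F G : {poly K}) (x : P1pt K) : Prop :=
  (2 <= locdeg d F G x)%N.

Definition is_berk (R : realType) (L : fieldType) (absv : L -> R)
    (n : {poly L} -> R) : Prop :=
  [/\ forall c, n c%:P = absv c,
      forall p q, n (p * q) = n p * n q
    & forall p q, n (p + q) <= n p + n q].

Definition A1an (R : realType) (L : fieldType) (absv : L -> R) :=
  {n : {poly L} -> R | is_berk absv n}.

Definition P1an (R : realType) (L : fieldType) (absv : L -> R) := option (A1an absv).

Definition bn (R : realType) (L : fieldType) (absv : L -> R) (z : A1an absv)
  (f : {poly L}) : R := proj1_sig z f.

(* T^{deg h} h(1/T) *)
Definition revpoly (L : fieldType) (h : {poly L}) : {poly L} :=
  \poly_(i < size h) h`_((size h).-1 - i).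

(* second chart P^1_an \ {0}, coordinate w = 1/T, identified with A^1_an *)
Definition in_chart2 (R : realType) (L : fieldType) (absv : L -> R) (x : P1an absv) : Prop :=
  match x with None => True | Some z => bn z 'X != 0 end.

(* |h|_{psi x} where psi : chart2 -> A^1_an is the chart map *)
Definition c2val (R : realType) (L : fieldType) (absv : L -> R) (h : {poly L})
    (x : P1an absv) : R :=
  match x with
  | None => absv h.[0]
  | Some z => bn z (revpoly h) / bn z 'X ^+ (size h).-1
  end.

(* Berkovich (weak) topology: U is open iff U meets each chart in an open set,
   A^1_an carrying the weakest topology making all z |-> |f|_z continuous *)
Definition P1_open (R : realType) (L : fieldType) (absv : L -> R)
    (U : P1an absv -> Prop) : Prop :=
  forall x, U x ->
    (forall z, x = Some z -> exists (fs : seq {poly L}) (e : R), 0 < e /\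
        forall w, (forall f, f \in fs -> `|bn w f - bn z f| < e) -> U (Some w)) /\
    (in_chart2 x -> exists (hs : seq {poly L}) (e : R), 0 < e /\
        forall y, in_chart2 y -> (forall h, h \in hs -> `|c2val h y - c2val h x| < e) -> U y).

Definition P1_connected (R : realType) (L : fieldType) (absv : L -> R)
    (S : P1an absv -> Prop) : Prop :=
  ~ exists U V, P1_open U /\ P1_open V /\
      (forall x, S x -> U x \/ V x) /\
      (exists x, S x /\ U x) /\ (exists x, S x /\ V x) /\
      (forall x, S x -> U x -> V x -> False).

(* homogenized composition: G^n * f(F/G) with n = deg f *)
Definition comp_hom (L : fieldType) (F G f : {poly L}) : {poly L} :=
  \sum_(i < size f) f`_i *: (F ^+ i * G ^+ ((size f).-1 - i)).

(* phi(x) = x for the Berkovich action of phi = F/G: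
   |f|_{phi(z)} = |f o phi|_z, phi(z) = oo when |G|_z = 0, phi(oo) = oo iff deg F > deg G *)
Definition berk_fixed (R : realType) (L : fieldType) (absv : L -> R)
    (F G : {poly L}) (x : P1an absv) : Prop :=
  match x with
  | None => (size G < size F)%N
  | Some z => bn z G != 0 /\
      forall f, bn z (comp_hom F G f) / bn z G ^+ (size f).-1 = bn z f
  end.

(* Main.v *)
Require Import Defs.
From HB Require Import structures.
From mathcomp Require Import all_boot all_order all_algebra.
From mathcomp Require Import reals.
From mathcomp Require Import boolp ring lra.
Set Implicit Arguments. Unset Strict Implicit. Unset Printing Implicit Defensive.
Import Order.TTheory GRing.Theory Num.Theory.
Local Open Scope ring_scope.

(** Since L is algebraically closed, a point z of the Berkovich affine line is
   determined by the values |T - c|_z, and phi = F/G fixes z if and only if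
   |F - c G|_z = |T - c|_z |G|_z for all c in L.  By good reduction the Gauss
   point is fixed, and every other fixed point lies in a residue disc whose
   class is fixed by the reduction of phi.

   In a noncritical fixed class, F - c G has exactly one root b in the residue
   disc, so |F - c G| = |T - b| there.  Hence phi acts on the disc as an
   isometry, and if z is fixed then so is every point z \/ t, 0 <= t <= 1, of
   the segment from z to the Gauss point.  In a critical fixed class, phi has an
   attracting fixed point b in L with |phi(T) - b|_z < |T - b|_z for the other
   points z of the disc; so b is isolated from the rest of the fixed locus by
   |T - b| < 1/2 and |T - b| > 1/2.  The class at infinity is moved to 0 by
   exchanging the two charts. *)

(** * Ultrametric seminorms and Gauss norms *)

Section Ultrametric.
Variables (R : realType) (A : comNzRingType) (N : A -> R).

Definition ultra_seminorm : Prop :=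
  [/\ N 0 = 0, N 1 = 1, forall x, 0 <= N x,
      forall x y, N (x * y) = N x * N y
    & forall x y, N (x + y) <= Num.max (N x) (N y)].

Hypothesis uN : ultra_seminorm.

Lemma ultra0 : N 0 = 0. Proof. by case: uN. Qed.
Lemma ultra1 : N 1 = 1. Proof. by case: uN. Qed.
Lemma ultra_ge0 x : 0 <= N x. Proof. by case: uN. Qed.
Lemma ultraM x y : N (x * y) = N x * N y. Proof. by case: uN. Qed.
Lemma ultraD x y : N (x + y) <= Num.max (N x) (N y). Proof. by case: uN. Qed.

Lemma ultraX x n : N (x ^+ n) = N x ^+ n.
Proof. by elim: n => [|n IH]; rewrite ?expr0 ?ultra1 // !exprS ultraM IH. Qed.

Lemma ultraN x : N (- x) = N x.
Proof.
suff e : N (-1) = 1 by rewrite -mulN1r ultraM e mul1r.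
apply/eqP; rewrite -(@pexpr_eq1 _ _ 2) ?ultra_ge0 //.
by rewrite -ultraX sqrrN expr1n ultra1.
Qed.

Lemma ultraB x y : N (x - y) <= Num.max (N x) (N y).
Proof. by rewrite -(ultraN y) ultraD. Qed.

Lemma ultra_distC x y : N (x - y) = N (y - x).
Proof. by rewrite -ultraN opprB. Qed.

Lemma ultraD_le x y B : N x <= B -> N y <= B -> N (x + y) <= B.
Proof. by move=> hx hy; rewrite (le_trans (ultraD x y)) // ge_max hx. Qed.

Lemma ultraB_le x y B : N x <= B -> N y <= B -> N (x - y) <= B.
Proof. by move=> hx hy; rewrite ultraD_le ?ultraN. Qed.

Lemma ultraD_lt x y B : N x < B -> N y < B -> N (x + y) < B.
Proof. by move=> hx hy; rewrite (le_lt_trans (ultraD x y)) // gt_max hx. Qed.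

Lemma ultraB_lt x y B : N x < B -> N y < B -> N (x - y) < B.
Proof. by move=> hx hy; rewrite ultraD_lt ?ultraN. Qed.

Lemma ultraDl x y : N y < N x -> N (x + y) = N x.
Proof.
move=> h; apply/eqP; rewrite eq_le ultraD_le ?(ltW h) //=.
have := ultraB (x + y) y; rewrite addrK le_max => /orP[//|].
by rewrite leNgt h.
Qed.

Lemma ultraDr x y : N x < N y -> N (x + y) = N y.
Proof. by rewrite addrC; apply: ultraDl. Qed.

Lemma ultraBl x y : N y < N x -> N (x - y) = N x.
Proof. by move=> h; rewrite ultraDl ?ultraN. Qed.

Lemma ultraBr x y : N x < N y -> N (x - y) = N y.
Proof. by move=> h; rewrite ultraDr ultraN. Qed.

Lemma ultra_sum_le (I : Type) (r : seq I) (P : pred I) (f : I -> A) B :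
  0 <= B -> (forall i, P i -> N (f i) <= B) -> N (\sum_(i <- r | P i) f i) <= B.
Proof.
move=> B0 h; elim/big_ind: _ => //; first by rewrite ultra0.
by move=> x y; apply: ultraD_le.
Qed.

Lemma ultra_sum_lt (I : Type) (r : seq I) (P : pred I) (f : I -> A) B :
  0 < B -> (forall i, P i -> N (f i) < B) -> N (\sum_(i <- r | P i) f i) < B.
Proof.
move=> B0 h; elim/big_ind: _ => //; first by rewrite ultra0.
by move=> x y; apply: ultraD_lt.
Qed.

Section GaussNorm.
Variable t : R.
Hypothesis t0 : 0 <= t.

(** The coefficient ring is general because two cases occur: [A] = L gives the Gauss point, and [A]
    = L[T] gives the path from a point towards infinity. *)
Definition gauss_norm (p : {poly A}) : R :=
  \big[Num.max/0]_(i < size p) (N p`_i * t ^+ i).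

Lemma gauss_norm_ge0 p : 0 <= gauss_norm p.
Proof. exact: bigmax_ge_id. Qed.

Lemma le_gauss_norm (p : {poly A}) i : N p`_i * t ^+ i <= gauss_norm p.
Proof.
have [h|h] := ltnP i (size p).
  exact: (le_bigmax 0 (fun i : 'I_(size p) => N p`_i * t ^+ i) (Ordinal h)).
by rewrite nth_default // ultra0 mul0r gauss_norm_ge0.
Qed.

Lemma gauss_norm_le (p : {poly A}) B :
  0 <= B -> (forall i, N p`_i * t ^+ i <= B) -> gauss_norm p <= B.
Proof. by move=> B0 h; apply: bigmax_le. Qed.

Lemma gauss_norm_attained (p : {poly A}) :
  0 < gauss_norm p -> exists i, N p`_i * t ^+ i == gauss_norm p.
Proof.
case: (ltnP 0 (size p)) => [s0 _|s0]; last first.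
  rewrite ltNge => /negP[]; apply: gauss_norm_le => // i.
  by rewrite nth_default ?ultra0 ?mul0r // (leq_trans s0).
have := @bigmax_eq_arg _ _ _ 0 (Ordinal s0) xpredT
  (fun i : 'I_(size p) => N p`_i * t ^+ i) isT.
rewrite -/(gauss_norm p) => -> => [|i _]; last by rewrite mulr_ge0 ?ultra_ge0 ?exprn_ge0.
by eexists; apply: eqxx.
Qed.

Lemma gauss_normC c : gauss_norm c%:P = N c.
Proof.
apply/eqP; rewrite eq_le; apply/andP; split; last first.
  by have := le_gauss_norm c%:P 0; rewrite coefC eqxx expr0 mulr1.
apply: gauss_norm_le => [|[|i]]; first exact: ultra_ge0.
  by rewrite coefC eqxx expr0 mulr1.
by rewrite coefC /= ultra0 mul0r ultra_ge0.
Qed.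

Lemma gauss_normD p q : gauss_norm (p + q) <= Num.max (gauss_norm p) (gauss_norm q).
Proof.
apply: gauss_norm_le => [|i]; first by rewrite le_max gauss_norm_ge0.
rewrite coefD; apply: (@le_trans _ _ (Num.max (N p`_i) (N q`_i) * t ^+ i)).
  by rewrite ler_wpM2r ?exprn_ge0 // ultraD.
rewrite maxr_pMl ?exprn_ge0 // ge_max !le_max !le_gauss_norm.
by rewrite orbT.
Qed.

Lemma gauss_normXDC c : gauss_norm ('X + c%:P) = Num.max (N c) t.
Proof.
apply/eqP; rewrite eq_le; apply/andP; split.
  apply: gauss_norm_le => [|i]; first by rewrite le_max ultra_ge0.
  rewrite coefD coefX coefC; case: i => [|[|i]] /=.
  - by rewrite add0r expr0 mulr1 le_max lexx.
  - by rewrite addr0 ultra1 mul1r expr1 le_max lexx orbT.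
  - by rewrite addr0 ultra0 mul0r le_max t0 orbT.
have := le_gauss_norm ('X + c%:P) 0; have := le_gauss_norm ('X + c%:P) 1.
rewrite !coefD !coefX !coefC /= !add0r !addr0 ultra1 mul1r expr0 mulr1 expr1.
by rewrite ge_max => -> ->.
Qed.

(* Gauss's lemma: the product of the first coefficients of [p] and of [q] of
   maximal weight strictly dominates the other terms of its coefficient. *)
Lemma gauss_normM p q : gauss_norm (p * q) = gauss_norm p * gauss_norm q.
Proof.
have wt_ge0 (r : {poly A}) i : 0 <= N r`_i * t ^+ i.
  by rewrite mulr_ge0 ?ultra_ge0 ?exprn_ge0.
have wtM i j (h : (j <= i)%N) :
    N (p`_j * q`_(i - j)) * t ^+ i
    = (N p`_j * t ^+ j) * (N q`_(i - j) * t ^+ (i - j)).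
  by rewrite ultraM -{2}(subnKC h) exprD; ring.
apply/eqP; rewrite eq_le; apply/andP; split.
  apply: gauss_norm_le => [|i]; first by rewrite mulr_ge0 ?gauss_norm_ge0.
  (* The weight vanishes when [t] = 0 and i > 0; otherwise it can be divided out. *)
  have [->|ti] := eqVneq (t ^+ i) 0; first by rewrite mulr0 mulr_ge0 ?gauss_norm_ge0.
  have ti0 : 0 < t ^+ i by rewrite lt_def ti exprn_ge0.
  rewrite -ler_pdivlMr // coefM.
  apply: ultra_sum_le => [|j _]; first by rewrite !mulr_ge0 ?gauss_norm_ge0 ?invr_ge0 ?ltW.
  rewrite ler_pdivlMr // wtM -1?ltnS //.
  by rewrite ler_pM ?le_gauss_norm.
have [p0|] := eqVneq (gauss_norm p) 0; first by rewrite p0 mul0r gauss_norm_ge0.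
have [q0|] := eqVneq (gauss_norm q) 0; first by rewrite q0 mulr0 gauss_norm_ge0.
move=> q0 p0.
have {q0} q0 : 0 < gauss_norm q by rewrite lt_def q0 gauss_norm_ge0.
have {p0} p0 : 0 < gauss_norm p by rewrite lt_def p0 gauss_norm_ge0.
case: (ex_minnP (gauss_norm_attained p0)) => i /eqP ei mi.
case: (ex_minnP (gauss_norm_attained q0)) => j /eqP ej mj.
suff e : N (p * q)`_(i + j) = N (p`_i * q`_j).
  apply: le_trans (le_gauss_norm (p * q) (i + j)).
  by rewrite e -ei -ej ultraM exprD le_eqVlt; apply/orP; left; apply/eqP; ring.
have tij : 0 < t ^+ (i + j).
  rewrite lt_def exprn_ge0 // andbT; apply/eqP => z.
  have : 0 < gauss_norm p * gauss_norm q by rewrite mulr_gt0.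
  suff -> : gauss_norm p * gauss_norm q = 0 by rewrite ltxx.
  by rewrite -ei -ej mulrACA -exprD z mulr0.
have ltij : (i < (i + j).+1)%N by rewrite ltnS leq_addr.
rewrite coefM (bigD1 (Ordinal ltij)) //= addKn; apply: ultraDl.
have pq0 : 0 < N (p`_i * q`_j).
  rewrite -(pmulr_lgt0 _ tij) ultraM exprD mulrACA ei ej mulr_gt0 //.
apply: ultra_sum_lt => // k nk.
have kle : (k <= i + j)%N by rewrite -ltnS.
rewrite -(ltr_pM2r tij) wtM // ultraM exprD [ltRHS]mulrACA ei ej.
have {nk} : k != i :> nat by [].
(* For k < i minimality of i makes the factor from [p] strictly smaller; for k > i the index i + j -
   k lies below j and the factor from [q] is strictly smaller. *)
rewrite neq_ltn => /orP[ki|ik].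
  apply: (@le_lt_trans _ _ (N p`_k * t ^+ k * gauss_norm q)).
    by rewrite ler_wpM2l ?le_gauss_norm.
  rewrite ltr_pM2r // lt_def le_gauss_norm andbT eq_sym.
  by apply/negP => /mi; rewrite leqNgt ki.
apply: (@le_lt_trans _ _ (gauss_norm p * (N q`_(i + j - k) * t ^+ (i + j - k)))).
  by rewrite ler_wpM2r ?le_gauss_norm.
rewrite ltr_pM2l // lt_def le_gauss_norm andbT eq_sym.
by apply/negP => /mj; rewrite leqNgt ltn_subLR // ltn_add2r ik.
Qed.

End GaussNorm.
End Ultrametric.

(** * Points of the Berkovich affine line *)

(** Every polynomial splits, so multiplicative quantities need checking only on constants and linear
    factors. The condition [p != 0] keeps degrees additive in the inductive step. *)
Lemma poly_split_ind (L : closedFieldType) (P : {poly L} -> Prop) :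
  (forall c, P c%:P) ->
  (forall c p, p != 0 -> P p -> P (('X - c%:P) * p)) -> forall p, P p.
Proof.
move=> PC PM p; have [r ->] := closed_field_poly_normal p.
have [->|a0] := eqVneq (lead_coef p) 0; first by rewrite scale0r -polyC0.
elim: r => [|c r IH]; first by rewrite big_nil alg_polyC.
rewrite big_cons scalerAr; apply: PM => //.
by rewrite scaler_eq0 negb_or a0 monic_neq0 ?monic_prod_XsubC.
Qed.

(** If x > y, then (x/y)^m would outgrow the linear factor m + 1. *)
Lemma le_of_expr_le (R : realType) (x y : R) : 0 <= y ->
  (forall m, x ^+ m <= m.+1%:R * y ^+ m) -> x <= y.
Proof.
move=> y0 h; rewrite leNgt; apply/negP => yx.
have {y0} y0 : 0 < y.
  rewrite lt_def y0 andbT; apply/eqP => yz; have := h 1%N.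
  by rewrite yz mulr0 leNgt expr1 -{1}yz yx.
pose d := x / y - 1.
have d0 : 0 < d by rewrite subr_gt0 ltr_pdivlMr // mul1r.
have h1 k : (1 + d) ^+ k <= k.+1%:R.
  by rewrite addrC subrK expr_div_n ler_pdivrMr ?exprn_gt0.
have bern k : 1 + k%:R * d <= (1 + d) ^+ k.
  elim: k => [|k IH]; first by rewrite mul0r addr0 expr0.
  have k0 : 0 <= k%:R :> R by [].
  have d1 : 0 <= 1 + d by lra.
  by rewrite exprS -natr1; have := ler_wpM2l d1 IH; nra.
(* Bernoulli at m, squared, bounds the power 2m from below, so (1 + m d)^2 <= 2m + 1; but m d^2 > 3
   forces m^2 d^2 > 3m >= 2m + 1. *)
have [m hm] : exists k : nat, 3 / d ^+ 2 < k%:R.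
  by exists (Num.bound (3 / d ^+ 2)); apply: archi_boundP; rewrite divr_ge0 ?exprn_ge0 ?ltW.
rewrite ltr_pdivrMr ?exprn_gt0 // in hm.
have m1 : 1 <= m%:R :> R.
  case: m hm => [|m _]; last by rewrite ler1n.
  by rewrite mul0r ltNge ler0n.
have := h1 (m + m)%N; rewrite exprD -natr1 natrD => h2.
have bm := bern m; have e0 : 0 <= m%:R * d by rewrite mulr_ge0 ?ler0n ?ltW.
have : (1 + m%:R * d) * (1 + m%:R * d) <= m%:R + m%:R + 1.
  by apply: le_trans h2; rewrite ler_pM ?addr_ge0.
nra.
Qed.

Section Berkovich.
Variables (R : realType) (L : closedFieldType) (absv : L -> R).
Hypothesis absvP : nonarch_abs absv.

Lemma absv_ultra : ultra_seminorm absv.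
Proof.
case: absvP => ge0 eq0 M D _; split=> //; first exact/eq0.
have n1 : absv 1 != 0 by apply/eqP => /eq0/eqP; rewrite oner_eq0.
by apply: (mulfI n1); rewrite -M !mulr1.
Qed.
Let uabs := absv_ultra.

Lemma absv_eq0 x : (absv x == 0) = (x == 0).
Proof. by case: absvP => _ eq0 _ _ _; apply/eqP/eqP => /eq0. Qed.

Lemma absvV x : absv x^-1 = (absv x)^-1.
Proof.
have [->|x0] := eqVneq x 0; first by rewrite !(invr0, ultra0 uabs).
by apply: (@mulfI _ (absv x)); rewrite ?absv_eq0 // -(ultraM uabs) !mulfV ?absv_eq0 // ultra1.
Qed.

Lemma absv_nat_le1 n : absv n%:R <= 1.
Proof.
elim: n => [|n IH]; first by rewrite ultra0.
by rewrite -natr1 (ultraD_le uabs) // ultra1.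
Qed.

(** Integers have absolute value at most 1, so expanding (p + q)^m and using the triangle inequality
    gives |p + q|^m <= (m + 1) max(|p|, |q|)^m; the factor m + 1 disappears by [le_of_expr_le]. *)
Lemma berk_ultra n : is_berk absv n -> ultra_seminorm n.
Proof.
move=> [nC nM nD].
have n0 : n 0 = 0 by rewrite -polyC0 nC ultra0.
have n1 : n 1 = 1 by rewrite -polyC1 nC ultra1.
have nN1 p : n (- p) = n p.
  by rewrite -mulN1r -polyC1 -polyCN nM nC (ultraN uabs) ultra1 // mul1r.
(* Nonnegativity comes from 0 = |p - p| <= 2 |p|. *)
have nge0 p : 0 <= n p.
  by have := nD p (- p); rewrite nN1 subrr n0 -mulr2n pmulrn_lge0.
have nX p m : n (p ^+ m) = n p ^+ m.
  by elim: m => [|m IH]; rewrite ?expr0 ?n1 // !exprS nM IH.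
have nsum (I : Type) (r : seq I) (f : I -> {poly L}) :
    n (\sum_(i <- r) f i) <= \sum_(i <- r) n (f i).
  elim: r => [|i r IH]; first by rewrite !big_nil n0.
  by rewrite !big_cons (le_trans (nD _ _)) // lerD2l.
split=> // p q; set B := Num.max _ _.
have B0 : 0 <= B by rewrite le_max nge0.
apply: le_of_expr_le => // m; rewrite -nX exprDn.
apply: le_trans (nsum _ _ _) _.
apply: (@le_trans _ _ (\sum_(i < m.+1) B ^+ m)); last first.
  by rewrite sumr_const card_ord mulr_natl.
apply: ler_sum => i _.
have ile : (i <= m)%N by rewrite -ltnS.
rewrite -mulr_natr nM -[in n _%:R]polyC_natr nC nM !nX -[leRHS]mulr1.
rewrite ler_pM ?absv_nat_le1 ?mulr_ge0 ?exprn_ge0 ?(ultra_ge0 uabs) //.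
rewrite -[in leRHS](subnK ile) exprD ler_pM ?exprn_ge0 // lerXn2r ?nnegrE //.
  by rewrite le_max lexx.
by rewrite le_max lexx orbT.
Qed.

Lemma ultra_berk n : ultra_seminorm n -> (forall c, n c%:P = absv c) -> is_berk absv n.
Proof.
move=> un nC; split=> // p q; first exact: ultraM.
by rewrite (le_trans (ultraD un _ _)) // ge_max lerDl lerDr !ultra_ge0.
Qed.

Lemma gauss_norm_ultra (A : comNzRingType) (N : A -> R) t :
  ultra_seminorm N -> 0 <= t -> ultra_seminorm (gauss_norm N t).
Proof.
move=> uN t0; split.
- by rewrite -polyC0 (gauss_normC uN) // (ultra0 uN).
- by rewrite -polyC1 (gauss_normC uN) // (ultra1 uN).
- exact: gauss_norm_ge0.
- exact: gauss_normM.
- exact: gauss_normD.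
Qed.

Lemma bn_ultra (z : A1an absv) : ultra_seminorm (bn z).
Proof. exact: berk_ultra (proj2_sig z). Qed.

Lemma bnC (z : A1an absv) c : bn z c%:P = absv c.
Proof. by have [nC _ _] := proj2_sig z; apply: nC. Qed.

Lemma bnZ (z : A1an absv) c f : bn z (c *: f) = absv c * bn z f.
Proof. by rewrite -mul_polyC (ultraM (bn_ultra z)) bnC. Qed.

Lemma berk_ext (z w : A1an absv) :
  (forall c, bn z ('X - c%:P) = bn w ('X - c%:P)) -> z = w.
Proof.
move=> h; suff: forall f, bn z f = bn w f.
  case: z w {h} => [n hn] [m hm] /= h.
  by apply: eq_exist; apply: funext => f; apply: h.
elim/poly_split_ind => [c|c p _ IH]; first by rewrite !bnC.
by rewrite !(ultraM (bn_ultra _)) IH h.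
Qed.

Lemma gauss_pt_berk : is_berk absv (gauss_norm absv 1).
Proof.
apply: ultra_berk; first exact: gauss_norm_ultra.
by move=> c; rewrite (gauss_normC uabs).
Qed.

Definition gauss_pt : A1an absv := exist _ _ gauss_pt_berk.

Lemma gauss_ptXC c : bn gauss_pt ('X - c%:P) = Num.max (absv c) 1.
Proof. by rewrite -polyCN [LHS](gauss_normXDC uabs) // (ultraN uabs). Qed.

Lemma gauss_pt_le1 (p : {poly L}) :
  (forall i, absv p`_i <= 1) -> bn gauss_pt p <= 1.
Proof.
by move=> h; apply: gauss_norm_le => // i; rewrite expr1n mulr1.
Qed.

Lemma gauss_pt_eq1 (p : {poly L}) :
  (forall i, absv p`_i <= 1) -> (exists i, absv p`_i = 1) -> bn gauss_pt p = 1.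
Proof.
move=> h [i hi]; apply/eqP; rewrite eq_le gauss_pt_le1 //=.
by have := le_gauss_norm uabs 1 p i; rewrite hi expr1n mulr1.
Qed.

Lemma type1_berk b : is_berk absv (fun f => absv f.[b]).
Proof.
apply: ultra_berk => [|c]; last by rewrite hornerC.
split=> [||x|x y|x y]; rewrite ?hornerM ?hornerD ?hornerC //.
- exact: ultra0.
- exact: ultra1.
- exact: ultra_ge0.
- exact: ultraM.
- exact: ultraD.
Qed.

(** The classical (type I) point [b]. Seeing it as a seminorm lets statements on residue discs apply
    to values of polynomials at [b]. *)
Definition type1_pt b : A1an absv := exist _ _ (type1_berk b).

Lemma type1_ptE b f : bn (type1_pt b) f = absv f.[b]. Proof. by []. Qed.

(* f(T + S) as a polynomial in S over L[T] *)
Definition shiftY (f : {poly L}) : {poly {poly L}} :=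
  map_poly polyC f \Po ('X + 'X%:P).

(* For t >= 0 this is the supremum norm on the relative disc of radius t
   around z, i.e. the point z \/ t of the path from z to infinity. *)
Lemma flow_berk (z : A1an absv) t : 0 <= t ->
  is_berk absv (fun f => gauss_norm (bn z) t (shiftY f)).
Proof.
move=> t0; have uz := bn_ultra z; have ug := gauss_norm_ultra uz t0.
have sC c : shiftY c%:P = c%:P%:P by rewrite /shiftY map_polyC comp_polyC.
apply: ultra_berk => [|c]; last by rewrite sC (gauss_normC uz) bnC.
split=> [||x|x y|x y].
- by rewrite -polyC0 sC (ultra0 ug).
- by rewrite -polyC1 sC (ultra1 ug).
- exact: ultra_ge0.
- by rewrite /shiftY rmorphM comp_polyM (ultraM ug).
- by rewrite /shiftY rmorphD comp_polyD (ultraD ug).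
Qed.

Definition flow (z : A1an absv) t (t0 : 0 <= t) : A1an absv :=
  exist _ _ (flow_berk z t0).

(** The shift turns T - c into S + (T - c), whose Gauss norm is immediate. *)
Lemma flowXC z t (t0 : 0 <= t) c :
  bn (flow z t0) ('X - c%:P) = Num.max (bn z ('X - c%:P)) t.
Proof.
rewrite /bn /= /shiftY rmorphB /= map_polyX map_polyC comp_polyB comp_polyX comp_polyC.
by rewrite -addrA -rmorphB /= gauss_normXDC //; apply: bn_ultra.
Qed.

(* On [0, 1] the functions t |-> |f|_(z \/ t) are products of t |-> max(a, t). *)
Lemma flow_lipschitz z f : exists2 C : R, 0 <= C &
  forall t s (t0 : 0 <= t) (s0 : 0 <= s), t <= 1 -> s <= 1 ->
    bn (flow z t0) f <= C /\ `|bn (flow z t0) f - bn (flow z s0) f| <= C * `|t - s|.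
Proof.
have uz := bn_ultra z.
elim/poly_split_ind: f => [c|c f _ [C C0 IH]].
  exists (absv c); first exact: ultra_ge0.
  by move=> *; rewrite !bnC lexx subrr normr0 mulr_ge0 ?(ultra_ge0 uabs).
set a := bn z ('X - c%:P).
have a0 : 0 <= a by apply: ultra_ge0.
have D0 : 0 <= a + 1 by rewrite addr_ge0.
(* On [0, 1] the factor max(a, t) is 1-Lipschitz and at most a + 1, so the product rule gives (a +
   1) C + C. *)
exists ((a + 2) * C) => [|t s t0 s0 t1 s1]; first by rewrite mulr_ge0 ?addr_ge0.
have [bt lts] := IH t s t0 s0 t1 s1; have [bs _] := IH s t s0 t0 s1 t1.
rewrite !(ultraM (bn_ultra _)) !flowXC -/a.
set x := Num.max a t; set y := Num.max a s.
have xa : 0 <= x <= a + 1 by rewrite /x; case: (leP a t) => ?; lra.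
have ya : 0 <= y <= a + 1 by rewrite /y; case: (leP a s) => ?; lra.
have xy : `|x - y| <= `|t - s|.
  rewrite /x /y; case: (leP a t) => ?; case: (leP a s) => ? //.
  - rewrite !ger0_norm; lra.
  - rewrite distrC [leRHS]distrC !ger0_norm; lra.
  - by rewrite subrr normr0.
have ge0 w : 0 <= bn w f := ultra_ge0 (bn_ultra w) f.
move: (ge0 (flow z t0)) (ge0 (flow z s0)) bt bs lts.
set u := bn _ f; set v := bn _ f => u0 v0 uC vC uv; split; first by nra.
have -> : x * u - y * v = x * (u - v) + (x - y) * v by ring.
rewrite (le_trans (ler_normD _ _)) // !normrM (ger0_norm v0) (@ger0_norm _ x); last by lra.
have n0 := normr_ge0 (t - s).
have h1 : x * `|u - v| <= (a + 1) * (C * `|t - s|) by rewrite ler_pM //; lra.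
have h2 : `|x - y| * v <= `|t - s| * C by rewrite ler_pM.
by apply: le_trans (lerD h1 h2) _; rewrite le_eqVlt; apply/orP; left; apply/eqP; ring.
Qed.

End Berkovich.

(** * Homogenized composition in a prescribed degree *)

Section HomogenizedComposition.
Variables (K : comNzRingType) (A B : {poly K}).

(** This is B^n p(A/B) for deg p <= n. Fixing n independently of p makes it linear in p; [comp_hom]
    is the case n = deg p, and [homrev] the case A = 1, B = T. *)
Definition hcomp n (p : {poly K}) : {poly K} :=
  \sum_(i < n.+1) p`_i *: (A ^+ i * B ^+ (n - i)).

Lemma hcomp0 n : hcomp n 0 = 0.
Proof. by apply: big1 => i _; rewrite coef0 scale0r. Qed.

Lemma hcompD n : {morph hcomp n : p q / p + q}.
Proof.
by move=> p q; rewrite -big_split; apply: eq_bigr => i _; rewrite coefD scalerDl.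
Qed.

Lemma hcompZ n c p : hcomp n (c *: p) = c *: hcomp n p.
Proof.
by rewrite /hcomp scaler_sumr; apply: eq_bigr => i _; rewrite coefZ scalerA.
Qed.

Lemma hcompXn n k : (k <= n)%N -> hcomp n 'X^k = A ^+ k * B ^+ (n - k).
Proof.
rewrite -ltnS => kn; rewrite /hcomp (bigD1 (Ordinal kn)) //= coefXn eqxx scale1r.
rewrite big1 ?addr0 // => i ni; rewrite coefXn; case: eqP => [e|_]; last by rewrite scale0r.
by case/eqP: ni; apply: val_inj.
Qed.

(** Both sides are bilinear, so monomials suffice; the size bounds ensure that truncation loses no
    coefficient. *)
Lemma hcompM m n (p q : {poly K}) : (size p <= m.+1)%N -> (size q <= n.+1)%N ->
  hcomp (m + n) (p * q) = hcomp m p * hcomp n q.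
Proof.
have expand k (r : {poly K}) : (size r <= k)%N -> r = \sum_(i < k) r`_i *: 'X^i.
  move=> rk; rewrite -poly_def; apply/polyP => i; rewrite coef_poly.
  by case: ltnP => // ki; rewrite nth_default // (leq_trans rk).
move=> sp sq; rewrite {1}(expand _ _ sp) {1}(expand _ _ sq) mulr_suml.
rewrite (big_morph _ (hcompD _) (hcomp0 _)) [in RHS]/hcomp mulr_suml.
apply: eq_bigr => i _; rewrite mulr_sumr (big_morph _ (hcompD _) (hcomp0 _)) mulr_sumr.
have im : (i <= m)%N by rewrite -ltnS.
apply: eq_bigr => j _; have jn : (j <= n)%N by rewrite -ltnS.
rewrite -!scalerAl -!scalerAr -exprD !hcompZ hcompXn ?leq_add //.
by rewrite [in RHS]mulrACA -!exprD subnDA addnBAC // addnBA // subnAC.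
Qed.

Lemma hcompC n c : hcomp n c%:P = c *: B ^+ n.
Proof. by rewrite -[c%:P]mulr1 mul_polyC -(expr0 'X) hcompZ hcompXn // mul1r subn0. Qed.

Lemma hcompXsubC c : hcomp 1 ('X - c%:P) = A - c *: B.
Proof.
by rewrite -polyCN hcompD -['X]expr1 hcompXn // hcompC mulr1 !expr1 scaleNr.
Qed.
End HomogenizedComposition.

(** * Residue discs and good reduction *)

Section ResidueDiscs.
Variables (R : realType) (L : closedFieldType) (absv : L -> R).
Hypothesis absvP : nonarch_abs absv.
Let uabs := absv_ultra absvP.
Let ubn (z : A1an absv) := bn_ultra absvP z.
Let gauss := gauss_pt absvP.

Lemma comp_homE (F G f : {poly L}) : comp_hom F G f = hcomp F G (size f).-1 f.
Proof.
rewrite /comp_hom /hcomp; have [->|f0] := eqVneq f 0.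
  by rewrite size_poly0 big_ord0 big_ord1 coef0 scale0r.
by rewrite prednK ?size_poly_gt0.
Qed.

(** Homogenized composition is multiplicative, so the condition for f is the product of those for
    its linear factors, and T - c is sent to F - c G. *)
Lemma berk_fixedP (F G : {poly L}) (z : A1an absv) :
  berk_fixed F G (Some z) <->
  bn z G != 0 /\ forall c, bn z (F - c *: G) = bn z ('X - c%:P) * bn z G.
Proof.
split=> [[G0 h]|[G0 h]]; split=> //.
  move=> c; have := h ('X - c%:P); rewrite comp_homE size_XsubC hcompXsubC expr1.
  by move=> <-; rewrite divfK.
move=> f; rewrite comp_homE; elim/poly_split_ind: f => [c|c f f0 IH].
  have -> : (size c%:P).-1 = 0%N by rewrite size_polyC; case: eqP.
  by rewrite hcompC !expr0 alg_polyC divr1.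
have sf : size f = (size f).-1.+1 by rewrite prednK ?size_poly_gt0.
have -> : (size (('X - c%:P) * f)).-1 = (1 + (size f).-1)%N.
  by rewrite size_monicM ?monicXsubC // size_XsubC {1}sf addSn.
rewrite hcompM ?size_XsubC -?sf // hcompXsubC !(ultraM (ubn z)) h -IH exprD expr1.
by field; rewrite expf_neq0.
Qed.

Lemma bnX_le1 (z : A1an absv) c :
  absv c <= 1 -> bn z ('X - c%:P) <= 1 -> bn z 'X <= 1.
Proof.
by move=> c1 z1; rewrite -['X](subrK c%:P) (ultraD_le (ubn z)) ?bnC.
Qed.

(** The Gauss norm is the maximum over the closed unit disc: each linear factor satisfies |T - c|_z
    <= max(|c|, 1). *)
Lemma bn_le_gauss (z : A1an absv) f : bn z 'X <= 1 -> bn z f <= bn gauss f.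
Proof.
move=> zX; elim/poly_split_ind: f => [c|c f _ IH]; first by rewrite !bnC.
rewrite !(ultraM (ubn _)) ler_pM ?(ultra_ge0 (ubn _)) // gauss_ptXC.
by rewrite (ultraB_le (ubn z)) ?bnC // le_max ?lexx ?zX ?orbT.
Qed.

Lemma gauss_quotient_le1 (Q : {poly L}) c :
  absv c <= 1 -> bn gauss (Q * ('X - c%:P)) <= 1 -> bn gauss Q <= 1.
Proof. by move=> c1; rewrite (ultraM (ubn _)) gauss_ptXC max_r // mulr1. Qed.

Section IntegralNear.
Variables (Q : {poly L}) (c : L) (z : A1an absv).
Hypotheses (Q1 : bn gauss Q <= 1) (c1 : absv c <= 1).

Lemma absv_horner_le1 : absv Q.[c] <= 1.
Proof.
rewrite -(type1_ptE absvP c Q) (le_trans (bn_le_gauss _ _)) //.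
by rewrite type1_ptE hornerX.
Qed.

Hypothesis zc : bn z ('X - c%:P) < 1.

Lemma bn_integral_le1 : bn z Q <= 1.
Proof. exact: le_trans (bn_le_gauss _ (bnX_le1 c1 (ltW zc))) Q1. Qed.

(** The quotient of Q - Q(c) by T - c is again integral, so the value is at most |T - c|_z. Thus the
    reduction of [Q] is constant on a residue disc. *)
Lemma bn_sub_horner_lt1 : bn z (Q - Q.[c]%:P) < 1.
Proof.
have /factor_theorem[Q' e] : root (Q - Q.[c]%:P) c.
  by rewrite rootE hornerD hornerN hornerC subrr.
apply: le_lt_trans zc; rewrite e (ultraM (ubn z)) ler_piMl ?(ultra_ge0 (ubn z)) //.
apply: le_trans (bn_le_gauss _ (bnX_le1 c1 (ltW zc))) _.
apply: (gauss_quotient_le1 c1); rewrite -e.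
by rewrite (ultraB_le (ubn _)) ?bnC ?absv_horner_le1.
Qed.

Lemma bn_lt1E : (bn z Q < 1) = (absv Q.[c] < 1).
Proof.
have h := bn_sub_horner_lt1; rewrite -(bnC z); apply/idP/idP => hQ.
  by rewrite -[_%:P](subKr Q) (ultraB_lt (ubn z)).
by rewrite -[Q](subrK Q.[c]%:P) (ultraD_lt (ubn z)).
Qed.

Lemma bn_eq1 : absv Q.[c] = 1 -> bn z Q = 1.
Proof.
move=> h; apply/eqP; rewrite eq_le bn_integral_le1 leNgt bn_lt1E h.
by rewrite ltxx.
Qed.
End IntegralNear.

(** The logarithmic derivative of [P] at c is the sum of the 1/(c - b) over the roots b, all of
    absolute value at most 1. *)
Lemma le_deriv_far_roots (P : {poly L}) c :
  (forall b, root P b -> 1 <= absv (c - b)) -> absv P^`().[c] <= absv P.[c].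
Proof.
elim/poly_split_ind: P => [a|b P P0 IH] h.
  by rewrite derivC horner0 (ultra0 uabs) (ultra_ge0 uabs).
have hb : 1 <= absv (c - b) by apply: h; rewrite rootM root_XsubC eqxx.
have {}IH : absv P^`().[c] <= absv P.[c] by apply: IH => a ra; apply: h; rewrite rootM ra orbT.
rewrite derivM derivXsubC mul1r !hornerE (ultraM uabs) (ultraD_le uabs) //.
  by rewrite ler_peMl ?(ultra_ge0 uabs).
by rewrite (ultraM uabs) ler_wpM2l ?(ultra_ge0 uabs).
Qed.

(** A form of Hensel's lemma: if every root were at distance at least 1 from c, then |P'(c)| <=
    |P(c)|. *)
Lemma root_near (P : {poly L}) c :
  absv P.[c] < 1 -> absv P^`().[c] = 1 -> exists2 b, root P b & absv (c - b) < 1.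
Proof.
move=> Pc dPc; apply: contrapT => h; move: Pc; apply/negP; rewrite -leNgt -dPc.
apply: le_deriv_far_roots => b rb; rewrite leNgt; apply/negP => hb.
by apply: h; exists b.
Qed.

Lemma gauss_deriv_le1 (Q : {poly L}) :
  (forall i, absv Q`_i <= 1) -> forall i, absv Q^`()`_i <= 1.
Proof.
move=> h i; rewrite coef_deriv -mulr_natr (ultraM uabs).
by rewrite mulr_ile1 ?(ultra_ge0 uabs) ?absv_nat_le1.
Qed.

(** If |c| differs from |T|_z, then |T - c|_z is the larger of the two; if they agree, both are at
    most 1. Either way max(|T - c|_z, 1) = max(|c|, 1). *)
Lemma flow1 (z : A1an absv) (t0 : 0 <= 1 :> R) : bn z 'X <= 1 -> flow absvP z t0 = gauss.
Proof.
move=> zX; apply: (berk_ext absvP) => c; rewrite flowXC gauss_ptXC.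
have [cz|zc] := ltP (absv c) (bn z 'X).
  rewrite (ultraBl (ubn z)) ?bnC // !max_r //.
  exact: le_trans (ltW cz) zX.
have [lt|eq] := ltrP (bn z 'X) (absv c).
  by rewrite (ultraBr (ubn z)) ?bnC.
have e : bn z 'X = absv c by apply/eqP; rewrite eq_le zc eq.
rewrite !max_r -?e //; apply: (ultraB_le (ubn z)) => //.
by rewrite bnC -e.
Qed.

Record good_red d (F G : {poly L}) : Prop := GoodRed {
  gr_sizeF : (size F <= d.+1)%N;
  gr_sizeG : (size G <= d.+1)%N;
  gr_F : forall i, absv F`_i <= 1;
  gr_G : forall i, absv G`_i <= 1;
  gr_fin : forall a, absv a <= 1 -> absv F.[a] = 1 \/ absv G.[a] = 1;
  gr_inf : absv F`_d = 1 \/ absv G`_d = 1;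
  gr_indep : forall a b, absv a <= 1 -> absv b <= 1 -> absv a = 1 \/ absv b = 1 ->
    exists i, absv (a * F`_i + b * G`_i) = 1 }.

(** With c held constant, the reduction of F - c G has at least a double zero at the class of c: the
    value expresses fixedness, the derivative criticality. *)
Definition fixed_critical_class (F G : {poly L}) (c : L) : Prop :=
  absv (F.[c] - c * G.[c]) < 1 /\ absv (F^`().[c] - c * G^`().[c]) < 1.

(** * Fixed points of a map with good reduction, one residue disc at a time *)

Section GoodReduction.
Variables (d : nat) (F G : {poly L}).
Hypothesis gFG : good_red d F G.

Let F1 : bn gauss F <= 1. Proof. exact: gauss_pt_le1 (gr_F gFG). Qed.
Let G1 : bn gauss G <= 1. Proof. exact: gauss_pt_le1 (gr_G gFG). Qed.
Let dF1 : bn gauss F^`() <= 1.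
Proof. exact: gauss_pt_le1 (gauss_deriv_le1 (gr_F gFG)). Qed.
Let dG1 : bn gauss G^`() <= 1.
Proof. exact: gauss_pt_le1 (gauss_deriv_le1 (gr_G gFG)). Qed.

Let subZ_le1 (A B : {poly L}) c : bn gauss A <= 1 -> bn gauss B <= 1 ->
  absv c <= 1 -> bn gauss (A - c *: B) <= 1.
Proof.
move=> A1 B1 c1; rewrite (ultraB_le (ubn _)) // bnZ //.
by rewrite mulr_ile1 ?(ultra_ge0 uabs) ?(ultra_ge0 (ubn _)).
Qed.

Lemma bn_gauss_comb a b : absv a <= 1 -> absv b <= 1 -> absv a = 1 \/ absv b = 1 ->
  bn gauss (a *: F + b *: G) = 1.
Proof.
move=> a1 b1 ab; apply: gauss_pt_eq1 => [i|].
  rewrite coefD !coefZ (ultraD_le uabs) // (ultraM uabs) mulr_ile1 ?(ultra_ge0 uabs) //.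
    exact: gr_F gFG _.
  exact: gr_G gFG _.
by have [i hi] := gr_indep gFG a1 b1 ab; exists i; rewrite coefD !coefZ.
Qed.

(** Independence of the reductions of F and G gives |F - c G| = max(|c|, 1) = |T - c| at the Gauss
    point. *)
Lemma gauss_fixed : berk_fixed F G (Some gauss).
Proof.
have a0 : absv 0 <= 1 by rewrite (ultra0 uabs).
have a1 : absv 1 = 1 by exact: ultra1 uabs.
have Ge : bn gauss G = 1.
  by rewrite -[G]scale1r -[_ *: G]add0r -(scale0r F) bn_gauss_comb ?a1 //; right.
apply/berk_fixedP; rewrite Ge oner_eq0; split=> // c; rewrite mulr1 gauss_ptXC.
have [c1|c1] := leP (absv c) 1.
  by rewrite -[F]scale1r -scaleNr bn_gauss_comb ?a1 ?(ultraN uabs) //; left.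
have c0 : c != 0 by rewrite -(absv_eq0 absvP) gt_eqF // (lt_trans _ c1).
(* For |c| > 1 the combination is rescaled to have integral coefficients, one of them a unit. *)
have -> : F - c *: G = c *: (c^-1 *: F + (-1) *: G).
  by rewrite scalerDr !scalerA mulfV // scale1r mulrN1 scaleNr.
rewrite bnZ // bn_gauss_comb ?mulr1 ?(ultraN uabs) ?a1 //; last by right.
by rewrite absvV // invf_le1 ?ltW // (lt_trans _ c1).
Qed.

(** At z, |F - c G| = |T - c| |G| < 1, and this inequality passes to c within the disc. If |G(c)| <
    1, then |F(c)| < 1 as well, against [gr_fin]. *)
Lemma fixed_in_class (z : A1an absv) c : berk_fixed F G (Some z) ->
  absv c <= 1 -> bn z ('X - c%:P) < 1 ->
  absv (F.[c] - c * G.[c]) < 1 /\ absv G.[c] = 1.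
Proof.
move=> /berk_fixedP[_ fz] c1 zc.
have h : absv (F.[c] - c * G.[c]) < 1.
  have := bn_lt1E (subZ_le1 F1 G1 c1) c1 zc; rewrite !hornerE => <-.
  rewrite fz; apply: le_lt_trans (zc); rewrite ler_piMr ?(ultra_ge0 (ubn z)) //.
  exact: bn_integral_le1 G1 c1 zc.
split=> //; have [Fc|//] := gr_fin gFG c1.
have Gc := absv_horner_le1 G1 c1.
apply/eqP; rewrite eq_le Gc leNgt; apply/negP => G'c.
move: h; rewrite (ultraBl uabs) ?Fc ?ltxx // (ultraM uabs).
by apply: le_lt_trans G'c; rewrite ler_piMl ?(ultra_ge0 uabs).
Qed.

Lemma flow_fixed (z : A1an absv) c t (t0 : 0 <= t) :
  berk_fixed F G (Some z) -> absv c <= 1 -> bn z ('X - c%:P) < 1 -> t <= 1 ->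
  ~ fixed_critical_class F G c -> berk_fixed F G (Some (flow absvP z t0)).
Proof.
move=> fz c1 zc t1 ncrit; have [Hc Gc] := fixed_in_class fz c1 zc.
have dHc : absv (F^`().[c] - c * G^`().[c]) = 1.
  have := absv_horner_le1 (subZ_le1 dF1 dG1 c1) c1; rewrite !hornerE le_eqVlt.
  by case/orP => [/eqP//|dHc]; case: ncrit.
(* The end of the path is the Gauss point, which lies in no residue disc. *)
have [t_eq1|t_ne1] := eqVneq t 1.
  by subst t; rewrite flow1 ?(bnX_le1 c1 (ltW zc)) //; apply: gauss_fixed.
have {t1 t_ne1} t1 : t < 1 by rewrite lt_neqAle t_ne1.
have [_ fz'] := (berk_fixedP F G z).1 fz.
have {fz'} fz' a : bn z (F - a *: G) = bn z ('X - a%:P).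
  by rewrite fz' (bn_eq1 G1 c1 zc Gc) mulr1.
set w := flow absvP z t0.
have wc : bn w ('X - c%:P) < 1 by rewrite flowXC gt_max zc.
apply/berk_fixedP; rewrite (bn_eq1 G1 c1 wc Gc) oner_eq0; split=> // a.
have Hw : bn w (F - c *: G) < 1.
  by rewrite (bn_lt1E (subZ_le1 F1 G1 c1) c1 wc) !hornerE.
(* If |a - c| >= 1, the terms F - c G and T - c are dominated, and both sides equal |a - c|. *)
rewrite mulr1; have [ac|ac] := leP 1 (absv (a - c)).
  have -> : F - a *: G = (F - c *: G) - (a - c) *: G by rewrite scalerBl; ring.
  have -> : 'X - a%:P = ('X - c%:P) - (a - c)%:P by rewrite polyCB; ring.
  have Gw : bn w ((a - c) *: G) = absv (a - c).
    by rewrite bnZ // (bn_eq1 G1 c1 wc Gc) mulr1.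
  rewrite (@ultraBr _ _ _ (ubn w) (F - c *: G)); last by rewrite Gw (lt_le_trans Hw).
  rewrite (@ultraBr _ _ _ (ubn w) ('X - c%:P)) ?bnC ?Gw //.
  exact: lt_le_trans wc ac.
(* F - a G has a single root b in the residue disc of c, and it is simple; so
   |F - a G| = |T - b| on this disc, and |T - b| = |T - a| at z forces the same
   equality along the flow. *)
have a1 : absv a <= 1 by rewrite -[a](subrK c) (ultraD_le uabs) // ltW.
have dGc1 := absv_horner_le1 dG1 c1.
have [b rb bc] : exists2 b, root (F - a *: G) b & absv (c - b) < 1.
  apply: root_near.
    have -> : (F - a *: G).[c] = (F.[c] - c * G.[c]) - (a - c) * G.[c].
      by rewrite !hornerE; ring.
    by rewrite (ultraB_lt uabs) // (ultraM uabs) Gc mulr1.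
  have -> : (F - a *: G)^`().[c] = (F^`().[c] - c * G^`().[c]) - (a - c) * G^`().[c].
    by rewrite derivB derivZ !hornerE; ring.
  rewrite (ultraBl uabs) // dHc (ultraM uabs); apply: le_lt_trans ac.
  by rewrite ler_piMr ?(ultra_ge0 uabs).
have b1 : absv b <= 1 by rewrite -[b](subKr c) (ultraB_le uabs) // ltW.
have /factor_theorem[Q eQ] := rb.
have Q1 : bn gauss Q <= 1 by apply: (gauss_quotient_le1 b1); rewrite -eQ subZ_le1.
(* Q(b) is the derivative of F - a G at b, a unit by noncriticality; hence |Q| = 1 on the whole
   disc. *)
have Qb : absv Q.[b] = 1.
  have -> : Q.[b] = (F - a *: G)^`().[b] by rewrite eQ derivM derivXsubC !hornerE; ring.
  have bpt : bn (type1_pt absvP b) ('X - c%:P) < 1.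
    by rewrite type1_ptE !hornerE (ultra_distC uabs).
  have dP1 := subZ_le1 dF1 dG1 a1.
  rewrite -type1_ptE derivB derivZ (bn_eq1 dP1 c1 bpt) //.
  have -> : (F^`() - a *: G^`()).[c] = (F^`().[c] - c * G^`().[c]) - (a - c) * G^`().[c].
    by rewrite !hornerE; ring.
  rewrite (ultraBl uabs) // dHc (ultraM uabs); apply: le_lt_trans ac.
  by rewrite ler_piMr ?(ultra_ge0 uabs).
have xb (y : A1an absv) : bn y ('X - c%:P) < 1 -> bn y (F - a *: G) = bn y ('X - b%:P).
  move=> yc; rewrite eQ (ultraM (ubn y)) (bn_eq1 Q1 b1) ?mul1r //.
  have -> : 'X - b%:P = ('X - c%:P) + (c - b)%:P by rewrite polyCB; ring.
  by rewrite (ultraD_lt (ubn y)) ?bnC.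
by rewrite (xb w wc) !flowXC -(xb z zc) fz'.
Qed.

(** Modulo the maximal ideal the derivative of F - T G at c is -G(c), a unit, so the disc contains a
    fixed point b. Criticality gives F - b G = (T - b) Q with |Q| < 1 on the disc, whereas a fixed z
    needs |F - b G|_z = |T - b|_z. *)
Lemma isolated_fixed_point c : absv c <= 1 -> fixed_critical_class F G c ->
  exists b, [/\ berk_fixed F G (Some (type1_pt absvP b)), absv b <= 1
    & forall z : A1an absv, berk_fixed F G (Some z) ->
        bn z ('X - b%:P) < 1 -> bn z ('X - b%:P) = 0].
Proof.
move=> c1 [Hc dHc].
have Gc : absv G.[c] = 1.
  have [Fc|//] := gr_fin gFG c1.
  have Gc := absv_horner_le1 G1 c1; apply/eqP; rewrite eq_le Gc leNgt; apply/negP => G'c.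
  move: Hc; rewrite (ultraBl uabs) ?Fc ?ltxx // (ultraM uabs).
  by apply: le_lt_trans G'c; rewrite ler_piMl ?(ultra_ge0 uabs).
have [b rb bc] : exists2 b, root (F - 'X * G) b & absv (c - b) < 1.
  apply: root_near; first by rewrite !hornerE.
  have -> : (F - 'X * G)^`().[c] = (F^`().[c] - c * G^`().[c]) - G.[c].
    by rewrite derivB derivM derivX !hornerE; ring.
  by rewrite (ultraBr uabs) Gc.
have b1 : absv b <= 1 by rewrite -[b](subKr c) (ultraB_le uabs) // ltW.
have bpt : bn (type1_pt absvP b) ('X - c%:P) < 1.
  by rewrite type1_ptE !hornerE (ultra_distC uabs).
have Gb : absv G.[b] = 1 by rewrite -(type1_ptE absvP) (bn_eq1 G1 c1 bpt).
have Fb : F.[b] = b * G.[b].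
  by move: rb; rewrite rootE !hornerE subr_eq0 => /eqP.
exists b; split=> // [|z /berk_fixedP[_ fz] zb].
  apply/berk_fixedP; rewrite !type1_ptE Gb oner_eq0; split=> // a.
  by rewrite !type1_ptE !hornerE Fb -mulrBl (ultraM uabs) Gb mulr1.
have /factor_theorem[Q eQ] : root (F - b *: G) b by rewrite rootE !hornerE Fb subrr.
have Q1 : bn gauss Q <= 1 by apply: (gauss_quotient_le1 b1); rewrite -eQ subZ_le1.
have Qb : absv Q.[b] < 1.
  have -> : Q.[b] = (F - b *: G)^`().[b] by rewrite eQ derivM derivXsubC !hornerE; ring.
  rewrite -(type1_ptE absvP) derivB derivZ (bn_lt1E (subZ_le1 dF1 dG1 b1) c1 bpt).
  have -> : (F^`() - b *: G^`()).[c] = (F^`().[c] - c * G^`().[c]) + (c - b) * G^`().[c].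
    by rewrite !hornerE; ring.
  rewrite (ultraD_lt uabs) // (ultraM uabs); apply: le_lt_trans bc.
  by rewrite ler_piMr ?(ultra_ge0 uabs) // (absv_horner_le1 dG1).
have Qz : bn z Q < 1 by rewrite (bn_lt1E Q1 b1 zb).
have := fz b; rewrite (bn_eq1 G1 b1 zb Gb) mulr1 eQ (ultraM (ubn z)) => e.
apply/eqP; apply: contraTT Qz => nz; rewrite -leNgt.
by have /(mulIf nz) -> : bn z Q * bn z ('X - b%:P) = 1 * bn z ('X - b%:P) by rewrite mul1r.
Qed.

End GoodReduction.
End ResidueDiscs.

(** * The exchange of the two charts *)

Section HomogeneousReversal.
Variable K : fieldType.
Implicit Types p q : {poly K}.

Lemma coef_homrev d p i : (homrev d p)`_i = if (i <= d)%N then p`_(d - i) else 0.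
Proof. by rewrite coef_poly ltnS. Qed.

Lemma homrev_hcomp d p : homrev d p = hcomp 1 'X d p.
Proof.
rewrite /homrev poly_def (reindex_inj rev_ord_inj) /=; apply: eq_bigr => i _.
by rewrite subSS subKn ?expr1n ?mul1r // -ltnS.
Qed.

Lemma size_homrev d p : (size (homrev d p) <= d.+1)%N.
Proof. exact: size_poly. Qed.

Lemma homrevK d p : (size p <= d.+1)%N -> homrev d (homrev d p) = p.
Proof.
move=> sp; apply/polyP => i; rewrite !coef_homrev; have [id|di] := leqP i d.
  by rewrite leq_subr subKn.
by rewrite nth_default // (leq_trans sp).
Qed.

Lemma homrevM m n p q : (size p <= m.+1)%N -> (size q <= n.+1)%N ->
  homrev (m + n) (p * q) = homrev m p * homrev n q.
Proof. by rewrite !homrev_hcomp; apply: hcompM. Qed.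

Lemma homrevD d p q : homrev d (p + q) = homrev d p + homrev d q.
Proof. by rewrite !homrev_hcomp hcompD. Qed.

Lemma homrevZ d c p : homrev d (c *: p) = c *: homrev d p.
Proof. by rewrite !homrev_hcomp hcompZ. Qed.

Lemma homrevC d (c : K) : homrev d c%:P = c *: 'X^d.
Proof. by rewrite homrev_hcomp hcompC. Qed.

Lemma homrevXsubC (c : K) : homrev 1 ('X - c%:P) = 1 - c *: 'X.
Proof. by rewrite homrev_hcomp hcompXsubC. Qed.

Lemma homrevX : homrev 1 'X = 1 :> {poly K}.
Proof. by rewrite -['X]subr0 -polyC0 homrevXsubC scale0r subr0. Qed.

Lemma homrev_widen d p : (size p <= d.+1)%N ->
  homrev d p = 'X^(d - (size p).-1) * homrev (size p).-1 p.
Proof.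
move=> sp; have le : ((size p).-1 <= d)%N by case: (size p) sp.
rewrite -{1}[p]mul1r -{1}(subnK le) homrevM ?leqSpred //.
  by rewrite homrevC scale1r.
by rewrite size_poly1.
Qed.

Lemma horner_homrev0 d p : (homrev d p).[0] = p`_d.
Proof. by rewrite horner_coef0 coef_homrev subn0. Qed.

Lemma deriv_homrev0 d p : (0 < d)%N -> (homrev d p)^`().[0] = p`_d.-1.
Proof. by case: d => // d _; rewrite horner_coef0 coef_deriv coef_homrev mulr1n /= subn1. Qed.

Lemma horner_homrev d p a : a != 0 -> (size p <= d.+1)%N ->
  (homrev d p).[a] = a ^+ d * p.[a^-1].
Proof.
move=> a0 sp; rewrite homrev_hcomp /hcomp horner_sum (horner_coef_wide _ sp) mulr_sumr.
apply: eq_bigr => i _; have id : (i <= d)%N by rewrite -ltnS.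
have -> : a ^+ d = a ^+ (d - i) * a ^+ i by rewrite -exprD subnK.
by rewrite expr1n mul1r !hornerE exprVn /= [_ * _ * p`_i]mulrAC mulfK ?expf_neq0 // mulrC.
Qed.

End HomogeneousReversal.

Lemma revpolyE (L : fieldType) (h : {poly L}) : revpoly h = homrev (size h).-1 h.
Proof.
have [->|h0] := eqVneq h 0.
  by apply/polyP => i; rewrite coef_homrev coef_poly size_poly0 !coef0 if_same.
by rewrite /revpoly /homrev prednK ?size_poly_gt0.
Qed.

Section ChartSwap.
Variables (R : realType) (L : closedFieldType) (absv : L -> R).
Hypothesis absvP : nonarch_abs absv.
Let uabs := absv_ultra absvP.
Let ubn (z : A1an absv) := bn_ultra absvP z.

(** The seminorm h |-> |h(1/T)|_z, in the form used by [c2val]. *)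
Definition swap_norm (z : A1an absv) (h : {poly L}) : R :=
  bn z (revpoly h) / bn z 'X ^+ (size h).-1.

(** Raising the degree adds powers of T that cancel against the denominator; a common d then makes
    sums and products comparable. *)
Lemma swap_normE d z (h : {poly L}) : bn z 'X != 0 -> (size h <= d.+1)%N ->
  swap_norm z h = bn z (homrev d h) / bn z 'X ^+ d.
Proof.
move=> z0 sh; have le : ((size h).-1 <= d)%N by case: (size h) sh.
rewrite (homrev_widen sh) (ultraM (ubn z)) (ultraX (ubn z)) /swap_norm revpolyE.
rewrite -[in X in _ = _ / X](subnK le) exprD.
by field; rewrite !expf_neq0.
Qed.

Lemma swap_berk z : bn z 'X != 0 -> is_berk absv (swap_norm z).
Proof.
move=> z0; split=> [c|p q|p q].
- by rewrite (swap_normE (d := 0) z0) ?size_polyC_leq1 // homrevC expr0 divr1 alg_polyC bnC.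
- rewrite (swap_normE (d := size p + size q) z0); last first.
    by rewrite (leq_trans (size_polyMleq _ _)) // (leq_trans (leq_pred _)).
  rewrite (swap_normE (d := size p) z0) // (swap_normE (d := size q) z0) //.
  by rewrite homrevM // (ultraM (ubn z)) exprD; field; rewrite !expf_neq0.
- set d := maxn (size p) (size q).
  have sp : (size p <= d.+1)%N by rewrite leqW // leq_maxl.
  have sq : (size q <= d.+1)%N by rewrite leqW // leq_maxr.
  have spq : (size (p + q)%R <= d.+1)%N by rewrite leqW // size_polyD.
  rewrite !(swap_normE (d := d) z0) // homrevD -mulrDl ler_wpM2r //.
    by rewrite invr_ge0 exprn_ge0 ?(ultra_ge0 (ubn z)).
  by have [_ _ nD] := proj2_sig z; apply: nD.
Qed.

(** The involution T |-> 1/T. Matching on [idP] supplies the proof of |T|_z != 0 that the seminorm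
    requires. *)
Definition swap (x : P1an absv) : P1an absv :=
  match x with
  | None => Some (type1_pt absvP 0)
  | Some z => match @idP (bn z 'X != 0) with
              | ReflectT h => Some (exist _ _ (swap_berk h))
              | ReflectF _ => None
              end
  end.

Lemma swap_unit z : bn z 'X != 0 ->
  exists2 w, swap (Some z) = Some w & forall h, bn w h = swap_norm z h.
Proof.
move=> z0; rewrite /swap; case: {-}_ / idP => [h|//].
by exists (exist _ _ (swap_berk h)).
Qed.

Lemma swap_zero z : bn z 'X = 0 -> swap (Some z) = None.
Proof. by move=> z0; rewrite /swap; case: {-}_ / idP => // h; case/eqP: (h). Qed.

Lemma bnX_eq0 (z : A1an absv) : bn z 'X = 0 -> z = type1_pt absvP 0.
Proof.
move=> z0; apply: (berk_ext absvP) => c; rewrite type1_ptE !hornerE (ultraN uabs).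
have [->|c0] := eqVneq c 0; first by rewrite subr0 z0 (ultra0 uabs).
by rewrite (ultraBr (ubn z)) bnC // z0 lt_def absv_eq0 // c0 (ultra_ge0 uabs).
Qed.

Lemma swap_c2val h w : c2val h (swap (Some w)) = bn w h.
Proof.
have [w0|w0] := eqVneq (bn w 'X) 0.
  by rewrite swap_zero // (bnX_eq0 w0).
have [v -> e] := swap_unit w0; rewrite /c2val !e.
have m1 : (size h <= (size h).-1.+1)%N by rewrite leqSpred.
rewrite revpolyE (swap_normE (d := (size h).-1) w0) ?size_homrev // homrevK //.
rewrite (swap_normE (d := 1) w0) ?size_polyX // homrevX (ultra1 (ubn w)).
rewrite expr1 div1r exprVn.
by field; rewrite expf_neq0.
Qed.

Lemma in_chart2_swap w : in_chart2 (swap (Some w)).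
Proof.
have [w0|w0] := eqVneq (bn w 'X) 0; first by rewrite swap_zero.
have [v e ev] := swap_unit w0; rewrite e /= ev.
by rewrite (swap_normE (d := 1) w0) ?size_polyX // homrevX (ultra1 (ubn w)) div1r invr_neq0.
Qed.

Lemma swap_chart2 x : in_chart2 x ->
  exists2 w, swap x = Some w & forall h, bn w h = c2val h x.
Proof.
case: x => [z z0|_]; first by have [w e h] := swap_unit z0; exists w.
by exists (type1_pt absvP 0).
Qed.

Lemma swapK : involutive swap.
Proof.
case=> [z|]; last by rewrite swap_zero ?type1_ptE ?hornerX ?(ultra0 uabs).
have [z0|z0] := eqVneq (bn z 'X) 0; first by rewrite swap_zero //= (bnX_eq0 z0).
have [w e h] := swap_chart2 (in_chart2_swap z); rewrite e; congr Some.
by apply: (berk_ext absvP) => c; rewrite h swap_c2val.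
Qed.

(** By [swap_c2val] and [swap_chart2] the conditions in the two charts are exchanged. *)
Lemma open_swap U : P1_open U -> P1_open (fun x => U (swap x)).
Proof.
move=> oU x /oU[h1 h2]; split=> [z xz|xc].
  have := h2; rewrite xz => /(_ (in_chart2_swap z))[hs [e [e0 h]]].
  exists hs, e; split=> // w hw; apply: h; first exact: in_chart2_swap.
  by move=> f fhs; rewrite !swap_c2val hw.
have [w xw hw] := swap_chart2 xc; have [hs [e [e0 h]]] := h1 _ xw.
exists hs, e; split=> // y yc hy; have [v yv hv] := swap_chart2 yc.
by rewrite yv; apply: h => f fhs; rewrite hv hw hy.
Qed.

Lemma swap_gauss : swap (Some (gauss_pt absvP)) = Some (gauss_pt absvP).
Proof.
have X1 : bn (gauss_pt absvP) 'X = 1.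
  by rewrite -['X]subr0 -polyC0 gauss_ptXC (ultra0 uabs) max_r.
have X0 : bn (gauss_pt absvP) 'X != 0 by rewrite X1 oner_eq0.
have [w -> h] := swap_unit X0; congr Some; apply: (berk_ext absvP) => c.
rewrite h (swap_normE (d := 1) X0) ?size_XsubC // X1 expr1 divr1 homrevXsubC gauss_ptXC.
have [->|c0] := eqVneq c 0.
  by rewrite scale0r subr0 (ultra1 (ubn _)) (ultra0 uabs) max_r.
have ac : 0 < absv c by rewrite lt_def absv_eq0 // c0 (ultra_ge0 uabs).
have -> : 1 - c *: 'X = (- c) *: ('X - (c^-1)%:P).
  rewrite scalerBr !scaleNr opprK -[_ *: _%:P]mul_polyC -polyCM mulfV // polyC1.
  by rewrite addrC.
rewrite bnZ // (ultraN uabs) gauss_ptXC absvV // maxr_pMr ?(ltW ac) //.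
by rewrite mulfV ?gt_eqF // mulr1 maxC.
Qed.

(** Conjugating F/G by 1/T gives G(1/T)^-1 inverted twice, that is G(1/T)/F(1/T). The new [gr_fin]
    comes from [gr_fin] at 1/a when |a| = 1 and from [gr_inf] when |a| < 1; the new [gr_inf] is
    [gr_fin] at 0. *)
Lemma good_red_swap d F G :
  good_red absv d F G -> good_red absv d (homrev d G) (homrev d F).
Proof.
move=> g; have coef_le1 (p : {poly L}) i :
    (forall j, absv p`_j <= 1) -> absv (homrev d p)`_i <= 1.
  by move=> h; rewrite coef_homrev; case: ifP; rewrite ?(ultra0 uabs).
have [sF sG] := (gr_sizeF g, gr_sizeG g).
split; rewrite ?size_homrev //.
- by move=> i; apply/coef_le1/(gr_G g).
- by move=> i; apply/coef_le1/(gr_F g).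
- move=> a a1; suff: absv (homrev d F).[a] = 1 \/ absv (homrev d G).[a] = 1 by tauto.
  move: a1; rewrite le_eqVlt => /orP[/eqP a1|a1].
    have a0 : a != 0 by rewrite -(absv_eq0 absvP) a1 oner_eq0.
    rewrite !horner_homrev // !(ultraM uabs) !(ultraX uabs) a1 expr1n !mul1r.
    by apply: (gr_fin g); rewrite absvV // a1 invr1.
  have c0 : absv 0 <= 1 by rewrite (ultra0 uabs).
  have za : bn (type1_pt absvP a) ('X - 0%:P) < 1 by rewrite type1_ptE !hornerE subr0.
  have near (p : {poly L}) : (forall j, absv p`_j <= 1) -> absv p`_d = 1 ->
      absv (homrev d p).[a] = 1.
    move=> h hd; rewrite -(type1_ptE absvP) (bn_eq1 _ c0 za) ?horner_homrev0 //.
    by apply: gauss_pt_le1 => i; apply: coef_le1.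
  by case: (gr_inf g) => h; [left|right]; apply: near => //; [exact: gr_F g|exact: gr_G g].
- rewrite !coef_homrev leqnn subnn -!horner_coef0.
  by have := gr_fin g (a := 0); rewrite (ultra0 uabs) => /(_ ler01); tauto.
- move=> a b a1 b1 ab; have ba : absv b = 1 \/ absv a = 1 by tauto.
  have [i hi] := gr_indep g b1 a1 ba; exists (d - i)%N.
  have id : (i <= d)%N.
    rewrite leqNgt; apply/negP => di; move: hi.
    rewrite !nth_default ?(leq_trans sF) ?(leq_trans sG) // !mulr0 addr0 (ultra0 uabs).
    by move/eqP; rewrite eq_sym oner_eq0.
  by rewrite !coef_homrev leq_subr subKn // addrC.
Qed.

Lemma swap_fixed d F G x : good_red absv d F G -> berk_fixed F G x ->
  berk_fixed (homrev d G) (homrev d F) (swap x).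
Proof.
move=> g; have [sF sG] := (gr_sizeF g, gr_sizeG g).
case: x => [z|sGF]; last first.
  have {}sGF : (size G < size F)%N := sGF.
  (* If infinity is fixed, the top coefficients are G_d = 0 and a unit F_d, so the conjugate map
     fixes 0. *)
  have Gd : G`_d = 0 by rewrite nth_default // -ltnS (leq_trans sGF).
  have Fd : absv F`_d = 1.
    case: (gr_inf g) => //; rewrite Gd (ultra0 uabs) => /eqP.
    by rewrite eq_sym oner_eq0.
  apply/(berk_fixedP absvP _ _ (type1_pt absvP 0)).
  rewrite !type1_ptE horner_homrev0 Fd oner_eq0; split=> // c.
  rewrite !type1_ptE !hornerE !horner_homrev0 Gd !sub0r !(ultraN uabs) (ultraM uabs).
  by rewrite Fd mulr1.
have [z0|z0] := eqVneq (bn z 'X) 0.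
  rewrite swap_zero // (bnX_eq0 z0) => /(berk_fixedP absvP)[].
  rewrite type1_ptE absv_eq0 // => G0 /(_ 0).
  rewrite scale0r subr0 !type1_ptE !hornerE oppr0 (ultra0 uabs) mul0r => /eqP.
  (* Here F(0) = 0 and G(0) != 0, so the reversed F has degree below d and the reversed G has degree
     d: infinity is fixed. *)
  rewrite absv_eq0 // => F0; apply: (@leq_ltn_trans d).
    apply/leq_sizeP => j dj; rewrite coef_homrev; case: leqP => // jd.
    have -> : j = d by apply/eqP; rewrite eqn_leq jd dj.
    by rewrite subnn -horner_coef0; apply/eqP.
  rewrite ltnNge; apply: contra G0 => /leq_sizeP/(_ _ (leqnn d)).
  by rewrite coef_homrev leqnn subnn -horner_coef0 => /eqP.
have [w -> e] := swap_unit z0 => /(berk_fixedP absvP)[G0 h].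
(* The condition at c = 0 makes |F|_z nonzero, so the new denominator does not vanish; for c != 0
   the new condition is the old one at 1/c. *)
have X1 : bn z F = bn z 'X * bn z G.
  by have := h 0; rewrite scale0r !subr0.
have eh (p : {poly L}) : (size p <= d.+1)%N -> bn w (homrev d p) = bn z p / bn z 'X ^+ d.
  by move=> sp; rewrite e (swap_normE (d := d) z0) ?size_homrev // homrevK.
have zd : bn z 'X ^+ d != 0 by rewrite expf_neq0.
apply/(berk_fixedP absvP); rewrite eh //; split=> [|c].
  by rewrite X1 !mulf_neq0 ?invr_neq0.
rewrite -homrevZ -scaleN1r -homrevZ -homrevD eh; last first.
  by rewrite (leq_trans (size_polyD _ _)) // geq_max sG !(leq_trans (size_scale_leq _ _)).
rewrite e (swap_normE (d := 1) z0) ?size_XsubC // homrevXsubC expr1 X1 scaleN1r.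
suff -> : bn z (G - c *: F) = bn z (1 - c *: 'X) * bn z G by field; rewrite z0 zd.
have [->|c0] := eqVneq c 0; first by rewrite !scale0r !subr0 (ultra1 (ubn z)) mul1r.
have -> : G - c *: F = (- c) *: (F - c^-1 *: G).
  by rewrite scalerBr scalerA !scaleNr mulNr mulfV // scaleN1r opprK addrC.
have -> : 1 - c *: 'X = (- c) *: ('X - (c^-1)%:P).
  rewrite scalerBr !scaleNr opprK -[_ *: _%:P]mul_polyC -polyCM mulfV // polyC1.
  by rewrite addrC.
by rewrite !bnZ // h mulrA.
Qed.

End ChartSwap.

(** * Connectedness of the fixed locus *)

Section Connectedness.
Variables (R : realType) (L : closedFieldType) (absv : L -> R).
Hypothesis absvP : nonarch_abs absv.
Let uabs := absv_ultra absvP.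
Let ubn (z : A1an absv) := bn_ultra absvP z.
Let gauss := gauss_pt absvP.

Definition separation (S U V : P1an absv -> Prop) : Prop :=
  P1_open U /\ P1_open V /\
      (forall x, S x -> U x \/ V x) /\
      (exists x, S x /\ U x) /\ (exists x, S x /\ V x) /\
      (forall x, S x -> U x -> V x -> False).

Lemma separation_sym S U V : separation S U V -> separation S V U.
Proof.
move=> [oU [oV [cov [eU [eV dis]]]]].
split=> //; split=> //; split; first by move=> x /cov; tauto.
by split=> //; split=> // x Sx Vx Ux; apply: dis Sx Ux Vx.
Qed.

Lemma separation_swap (S S' U V : P1an absv -> Prop) :
  (forall x, S' x <-> S (swap absvP x)) -> separation S U V ->
  separation S' (fun x => U (swap absvP x)) (fun x => V (swap absvP x)).
Proof.
move=> SS' [oU [oV [cov [[x [Sx Ux]] [[y [Sy Vy]] dis]]]]].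
have toS' u : S u -> S' (swap absvP u) by move=> Su; apply/SS'; rewrite swapK.
split; first exact: open_swap.
split; first exact: open_swap.
split; first by move=> u /SS'/cov.
split; first by exists (swap absvP x); rewrite swapK; split=> //; apply: toS'.
split; first by exists (swap absvP y); rewrite swapK; split=> //; apply: toS'.
by move=> u /SS'; apply: dis.
Qed.

(** * Continuity and connectedness of the path to the Gauss point *)

Lemma flow_equicontinuous z (fs : seq {poly L}) (e : R) : 0 < e -> exists2 dl : R, 0 < dl &
  forall t s (t0 : 0 <= t) (s0 : 0 <= s), t <= 1 -> s <= 1 -> `|t - s| < dl ->
    forall f, f \in fs -> `|bn (flow absvP z t0) f - bn (flow absvP z s0) f| < e.
Proof.
move=> e0; elim: fs => [|f fs [dl dl0 IH]]; first by exists 1.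
have [C C0 hC] := flow_lipschitz absvP z f.
have C1 : 0 < C + 1 by lra.
exists (Num.min dl (e / (C + 1))); first by rewrite lt_min dl0 divr_gt0.
move=> t s t0 s0 t1 s1; rewrite lt_min => /andP[ts1 ts2] h.
rewrite inE => /orP[/eqP->|]; last exact: IH.
have [_ le] := hC t s t0 s0 t1 s1; apply: le_lt_trans le _.
rewrite ltr_pdivlMr // in ts2; apply: le_lt_trans ts2.
by have := normr_ge0 (t - s); nra.
Qed.

Lemma flow_open (U : P1an absv -> Prop) z t (t0 : 0 <= t) :
  P1_open U -> t <= 1 -> U (Some (flow absvP z t0)) ->
  exists2 dl : R, 0 < dl &
    forall s (s0 : 0 <= s), s <= 1 -> `|s - t| < dl -> U (Some (flow absvP z s0)).
Proof.
move=> oU t1 /oU[/(_ _ erefl)[fs [e [e0 h]]] _].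
have [dl dl0 hdl] := flow_equicontinuous z fs e0.
by exists dl => // s s0 s1 st; apply: h; apply: hdl.
Qed.

Lemma flow0 z (t0 : 0 <= 0 :> R) : flow absvP z t0 = z.
Proof.
by apply: (berk_ext absvP) => c; rewrite flowXC max_l // (ultra_ge0 (ubn z)).
Qed.

(** The connectedness of [0, 1], carried along the path: the supremum of the times spent in V can
    lie neither in U nor in V. *)
Lemma flow_not_separated (S U V : P1an absv -> Prop) z :
  separation S U V ->
  (forall t (t0 : 0 <= t), t <= 1 -> S (Some (flow absvP z t0))) ->
  U (Some (flow absvP z ler01)) -> V (Some z) -> False.
Proof.
move=> [oU [oV [cov [_ [_ dis]]]]] Sz U1 V0.
(* The proof of 0 <= t is quantified because [flow] takes it as an argument. *)
pose E (t : R) : Prop := t <= 1 /\ exists t0 : 0 <= t, V (Some (flow absvP z t0)).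
have E0 : E 0 by split=> //; exists (lexx 0); rewrite flow0.
have bE : classical_sets.has_ubound E by exists 1 => t [].
have s0 : 0 <= sup E := ub_le_sup bE E0.
have s1 : sup E <= 1 by apply: ge_sup; [exists 0|move=> t []].
case: (cov _ (Sz _ s0 s1)) => [Us|Vs].
  have [dl dl0 h] := flow_open oU s1 Us.
  have [t Et st] := sup_adherent dl0 (conj (ex_intro _ _ E0) bE).
  have ts := ub_le_sup bE Et; have [t1 [t0 Vt]] := Et.
  apply: dis (Sz _ t0 t1) _ Vt; apply: h => //.
  by rewrite distrC ger0_norm ?subr_ge0 //; lra.
have [dl dl0 h] := flow_open oV s1 Vs.
have [s_eq1|s_ne1] := eqVneq (sup E) 1.
  apply: dis (Sz _ ler01 (lexx 1)) U1 (h _ _ _ _) => //.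
  by rewrite s_eq1 subrr normr0.
have s_lt1 : sup E < 1 by rewrite lt_neqAle s_ne1.
(* A time after the supremum, still in [0, 1] and within the neighbourhood contained in V. *)
pose t := Num.min 1 (sup E + dl / 2).
have st : sup E < t by rewrite lt_min s_lt1 ltrDl divr_gt0.
have t0 : 0 <= t by apply: le_trans s0 (ltW st).
have t1 : t <= 1 by rewrite ge_min lexx.
have tdl : t <= sup E + dl / 2 by rewrite ge_min lexx orbT.
have /(ub_le_sup bE) : E t; last by rewrite leNgt st.
split=> //; exists t0; apply: h => //.
by rewrite ger0_norm ?subr_ge0 ?(ltW st) //; lra.
Qed.

(** * Open discs and exteriors of closed discs *)

Definition disc_in (b : L) (s : R) (x : P1an absv) : Prop :=
  if x is Some z then is_true (bn z ('X - b%:P) < s) else False.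

Definition disc_out (b : L) (s : R) (x : P1an absv) : Prop :=
  if x is Some z then is_true (s < bn z ('X - b%:P)) else True.

(** With w = 1/T, comparing |T - b| with s becomes comparing |1 - b w| with s |w|, which makes sense
    at infinity. *)
Lemma disc_chart2 b s x : in_chart2 x ->
  (disc_in b s x <-> c2val (1 - b *: 'X) x < s * c2val 'X x) /\
  (disc_out b s x <-> s * c2val 'X x < c2val (1 - b *: 'X) x).
Proof.
case: x => [z z0|_] /=; last first.
  rewrite !hornerE ?mulr0 ?subr0 (ultra0 uabs) mulr0 (ultra1 uabs) ltr01.
  by split=> //; split=> //; rewrite ltNge ler01.
have zp : 0 < bn z 'X by rewrite lt_def z0 (ultra_ge0 (ubn z)).
rewrite -![bn z (revpoly _) / _]/(swap_norm _ _).
have sq : (size (1 - b *: 'X : {poly L})%R <= 2)%N by rewrite -homrevXsubC size_homrev.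
rewrite !(swap_normE absvP (d := 1) z0) ?size_polyX // homrevX (ultra1 (ubn z)).
rewrite -homrevXsubC homrevK ?size_XsubC // mulrA mulr1 !ltr_pM2r ?invr_gt0 //.
Qed.

(** Errors below e in u and v change s u - v by less than (1 + s) e, here the whole gap. *)
Lemma open_comparison (u v u0 v0 s : R) : 0 <= s -> v0 < s * u0 ->
  `|u - u0| < (s * u0 - v0) / (1 + s) -> `|v - v0| < (s * u0 - v0) / (1 + s) -> v < s * u.
Proof.
move=> s0 h; have s1 : 0 < 1 + s by lra.
set e := _ / _; have he : e * (1 + s) = s * u0 - v0 by rewrite divfK ?gt_eqF.
by rewrite !ltr_norml => /andP[u1 u2] /andP[v1 v2]; nra.
Qed.

Lemma open_disc_in b s : 0 <= s -> P1_open (disc_in b s).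
Proof.
move=> s0 x dx; split=> [z xz|xc].
  move: dx; rewrite xz /= => zs; exists [:: 'X - b%:P], (s - bn z ('X - b%:P)).
  rewrite subr_gt0; split=> // w /(_ _ (mem_head _ _)).
  by rewrite ltr_norml => /andP[_]; rewrite ltrBlDr subrK.
have s1 : 0 < 1 + s by lra.
have lt := (disc_chart2 b s xc).1.1 dx.
exists [:: 'X; 1 - b *: 'X], ((s * c2val 'X x - c2val (1 - b *: 'X) x) / (1 + s)).
split=> [|y yc hy]; first by rewrite divr_gt0 ?subr_gt0.
apply/(disc_chart2 b s yc).1; apply: open_comparison s0 lt _ _; apply: hy.
  exact: mem_head.
by rewrite in_cons mem_head orbT.
Qed.

Lemma open_disc_out b s : 0 < s -> P1_open (disc_out b s).
Proof.
move=> s0 x dx; split=> [z xz|xc].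
  move: dx; rewrite xz /= => zs; exists [:: 'X - b%:P], (bn z ('X - b%:P) - s).
  rewrite subr_gt0; split=> // w /(_ _ (mem_head _ _)).
  by rewrite ltr_norml => /andP[+ _]; rewrite opprB ltrBDr subrK.
(* Dividing by s brings the exterior to the form of [open_comparison] with slope 1/s. *)
have i0 : 0 <= s^-1 by rewrite invr_ge0 ltW.
have s1 : 0 < 1 + s^-1 by lra.
have lt : c2val 'X x < s^-1 * c2val (1 - b *: 'X) x.
  by rewrite mulrC ltr_pdivlMr // mulrC; apply/(disc_chart2 b s xc).2.
exists [:: 'X; 1 - b *: 'X], ((s^-1 * c2val (1 - b *: 'X) x - c2val 'X x) / (1 + s^-1)).
split=> [|y yc hy]; first by rewrite divr_gt0 ?subr_gt0.
apply/(disc_chart2 b s yc).2; rewrite mulrC -ltr_pdivlMr // mulrC.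
apply: open_comparison i0 lt _ _; apply: hy; last exact: mem_head.
by rewrite in_cons mem_head orbT.
Qed.

(** * Separation of the fixed locus and fixed critical classes *)

Lemma critical_class_disconnects d F G c : good_red absv d F G ->
  absv c <= 1 -> fixed_critical_class absv F G c ->
  exists U V, separation (berk_fixed (absv := absv) F G) U V.
Proof.
move=> g c1 crit; have [b [fb b1 hb]] := isolated_fixed_point absvP g c1 crit.
have half : 0 < 2^-1 :> R by rewrite invr_gt0.
(* On the fixed locus |T - b| is either 0 or at least 1; b and the Gauss point witness the two
   pieces. *)
exists (disc_in b 2^-1), (disc_out b 2^-1).
split; first by apply: open_disc_in; rewrite ltW.
split; first exact: open_disc_out.
have half1 : 2^-1 < 1 :> R by rewrite invf_lt1 // ltr1n.
split.
  case=> [z fz|_]; last by right.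
  have [zb|zb] := ltP (bn z ('X - b%:P)) 1.
    by left; rewrite /disc_in (hb z).
  by right; apply: lt_le_trans zb.
split.
  exists (Some (type1_pt absvP b)); split=> //.
  by rewrite /disc_in type1_ptE !hornerE subrr (ultra0 uabs).
split.
  exists (Some gauss); split; first exact: gauss_fixed g.
  by rewrite /disc_out gauss_ptXC max_r.
by case=> // z _ h1 h2; move: (lt_trans h1 h2); rewrite ltxx.
Qed.

Lemma noncritical_not_separated d F G U V z c : good_red absv d F G ->
  separation (berk_fixed (absv := absv) F G) U V ->
  U (Some gauss) -> berk_fixed F G (Some z) -> V (Some z) ->
  absv c <= 1 -> bn z ('X - c%:P) < 1 -> fixed_critical_class absv F G c.
Proof.
move=> g sep Ug fz Vz c1 zc; apply: contrapT => ncrit.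
apply: (flow_not_separated sep) (Vz) => [t t0 t1|].
  exact: (flow_fixed absvP g t0 fz c1 zc t1 ncrit).
by rewrite flow1 ?(bnX_le1 absvP c1 (ltW zc)).
Qed.

(** A point in no residue disc has |T - c|_z = 1 for all |c| <= 1, as the Gauss point does. *)
Lemma unit_disc_cases (z : A1an absv) : bn z 'X <= 1 ->
  z = gauss \/ exists2 c, absv c <= 1 & bn z ('X - c%:P) < 1.
Proof.
move=> zX; case: (pselect (exists2 c, absv c <= 1 & bn z ('X - c%:P) < 1)); first by right.
move=> nc; left; apply: (berk_ext absvP) => c; rewrite gauss_ptXC.
have [c1|c1] := leP (absv c) 1.
  apply/eqP; rewrite eq_le (ultraB_le (ubn z)) ?bnC //= leNgt; apply/negP => zc.
  by apply: nc; exists c.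
by rewrite (ultraBr (ubn z)) ?bnC // (le_lt_trans zX).
Qed.

Lemma connected_fixed_locusP d F G : good_red absv d F G ->
  P1_connected (berk_fixed (absv := absv) F G) <->
  ~ ((exists2 c, absv c <= 1 & fixed_critical_class absv F G c) \/
     fixed_critical_class absv (homrev d G) (homrev d F) 0).
Proof.
move=> g; have g' := good_red_swap absvP g.
have z1 : absv 0 <= 1 by rewrite (ultra0 uabs).
have fixE x : berk_fixed F G x <-> berk_fixed (homrev d G) (homrev d F) (swap absvP x).
  split; first exact: swap_fixed.
  move=> /(swap_fixed absvP g'); rewrite swapK !homrevK //; first exact: gr_sizeG g.
  exact: gr_sizeF g.
split=> [con|ncrit [U [V sep]]].
  case=> [[c c1 crit]|crit]; first exact: con (critical_class_disconnects g c1 crit).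
  have [U [V sep]] := critical_class_disconnects g' z1 crit.
  by apply: con; do 2!eexists; apply: separation_swap sep.
(* The Gauss point is fixed, hence in one of the two sets, and their roles are symmetric. *)
wlog Ug : U V sep / U (Some gauss).
  move=> wl; have [_ [_ [cov _]]] := sep.
  by case: (cov _ (gauss_fixed absvP g)) => h; [exact: wl sep h|exact: wl (separation_sym sep) h].
have [_ [_ [_ [_ [[x [fx Vx]] dis]]]]] := sep.
(* Points with |T| > 1, and infinity, are treated in the other chart as points of the residue disc
   of 0. *)
have at_infinity w : swap absvP x = Some w -> bn w 'X < 1 -> False.
  move=> xw w1; apply: ncrit; right.
  have fixE' y : berk_fixed (homrev d G) (homrev d F) y <-> berk_fixed F G (swap absvP y).
    by rewrite fixE swapK.
  apply: (noncritical_not_separated (z := w) g' (separation_swap fixE' sep)) => //.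
  - by rewrite swap_gauss.
  - by rewrite -xw; apply/fixE.
  - by rewrite -xw swapK.
  - by rewrite subr0.
case: x fx Vx at_infinity => [z|] fx Vx at_inf; last first.
  by apply: (at_inf _ erefl); rewrite type1_ptE hornerX (ultra0 uabs).
have [zX|zX] := leP (bn z 'X) 1; last first.
  have z0 : bn z 'X != 0 by rewrite gt_eqF // (lt_trans _ zX).
  have [w e h] := swap_unit absvP z0; apply: (at_inf w e).
  rewrite h (swap_normE absvP (d := 1) z0) ?size_polyX // homrevX (ultra1 (ubn z)).
  by rewrite expr1 div1r invf_lt1 // (lt_trans _ zX).
have [zg|[c c1 zc]] := unit_disc_cases zX.
  by subst z; apply: dis fx Ug Vx.
apply: ncrit; left; exists c => //.
exact: noncritical_not_separated g sep Ug fx Vx c1 zc.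
Qed.

End Connectedness.

(** * Reduction modulo the maximal ideal *)

(** For order two the derivative test holds in every characteristic, and the residue field may have
    positive characteristic. *)
Lemma mup_geq2 (K : fieldType) (p : {poly K}) a : p != 0 ->
  (2 <= mup a p)%N = (p.[a] == 0) && (p^`().[a] == 0).
Proof.
move=> p0; rewrite mup_geq //; apply/idP/andP => [/dvdpP[q ->]|[pa dpa]].
  rewrite expr2 mulrA !derivM derivXsubC !mulr1 !(hornerXsubC, hornerD, hornerM) subrr.
  by rewrite !mulr0 ?addr0 eqxx.
have /factor_theorem[q e] : root p a by [].
have : root q a by move: dpa; rewrite e derivM derivXsubC !hornerE subrr mulr0 add0r.
by move=> /factor_theorem[r e']; rewrite e e' -mulrA -expr2 dvdp_mulIr.
Qed.

(** A nontrivial relation makes one polynomial a multiple of the other, which then divides the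
    constant gcd. *)
Lemma gcd_const_size (K : fieldType) (p q : {poly K}) a b :
  size (gcdp p q) = 1%N -> (a != 0) || (b != 0) -> a *: p + b *: q = 0 ->
  (maxn (size p) (size q) <= 1)%N.
Proof.
move=> s1; have g0 : gcdp p q != 0 by rewrite -size_poly_eq0 s1.
wlog a0 : a b p q s1 g0 / a != 0 => [wl ab|_].
  have [a0|a0] := eqVneq a 0; last exact: wl ab.
  move: ab; rewrite a0 eqxx /= => b0; rewrite addrC maxnC.
  have g' : size (gcdp q p) = 1%N by rewrite -s1; apply: eqp_size; apply: gcdpC.
  by apply: wl => //; rewrite ?b0 // -size_poly_eq0 g'.
move/eqP; rewrite addr_eq0 => /eqP e.
have {e} e : p = (- (a^-1 * b)) *: q.
  by rewrite scaleNr -scalerA -scalerN -e scalerA mulVf // scale1r.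
have qg : q %| gcdp p q by rewrite dvdp_gcd dvdpp andbT e -mul_polyC dvdp_mulIr.
have := dvdp_leq g0 qg; rewrite s1 geq_max => sq; rewrite sq andbT.
by rewrite e (leq_trans (size_scale_leq _ _)).
Qed.

Section Reduction.
Variables (R : realType) (L : closedFieldType) (absv : L -> R) (k : fieldType) (red : L -> k).
Hypothesis absvP : nonarch_abs absv.
Hypothesis redP : residue_field absv red.
Let uabs := absv_ultra absvP.

Lemma red_eq0 x : absv x <= 1 -> (red x == 0) = (absv x < 1).
Proof. by have [_ _ _ h _] := redP => /h[h1 h2]; apply/eqP/idP. Qed.

Lemma red0 : red 0 = 0.
Proof. by apply/eqP; rewrite red_eq0 (ultra0 uabs). Qed.

Lemma redD x y : absv x <= 1 -> absv y <= 1 -> red (x + y) = red x + red y.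
Proof. by have [h _ _ _ _] := redP; apply: h. Qed.

Lemma redM x y : absv x <= 1 -> absv y <= 1 -> red (x * y) = red x * red y.
Proof. by have [_ h _ _ _] := redP; apply: h. Qed.

Lemma red_neq0 x : absv x <= 1 -> red x != 0 -> absv x = 1.
Proof. by move=> x1; rewrite red_eq0 // -leNgt => h; apply/eqP; rewrite eq_le x1. Qed.

Lemma redN x : absv x <= 1 -> red (- x) = - red x.
Proof.
by move=> x1; apply/eqP; rewrite -addr_eq0 -redD ?(ultraN uabs) // addNr red0.
Qed.

Lemma absvM_le1 x y : absv x <= 1 -> absv y <= 1 -> absv (x * y) <= 1.
Proof. by move=> x1 y1; rewrite (ultraM uabs) mulr_ile1 ?(ultra_ge0 uabs). Qed.

Lemma redX x n : absv x <= 1 -> red (x ^+ n) = red x ^+ n.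
Proof.
move=> x1; elim: n => [|n IH]; first by have [_ _ h _ _] := redP; rewrite !expr0.
by rewrite !exprS redM ?IH // (ultraX uabs) exprn_ile1 ?(ultra_ge0 uabs).
Qed.

Lemma red_sum (I : Type) (r : seq I) (f : I -> L) : (forall i, absv (f i) <= 1) ->
  red (\sum_(i <- r) f i) = \sum_(i <- r) red (f i).
Proof.
move=> h; elim: r => [|i r IH]; first by rewrite !big_nil red0.
by rewrite !big_cons redD ?IH // (ultra_sum_le uabs).
Qed.

Lemma coef_red (p : {poly L}) i : (map_poly red p)`_i = red p`_i.
Proof. by rewrite coef_map_id0 ?red0. Qed.

Lemma horner_red (p : {poly L}) a : (forall i, absv p`_i <= 1) -> absv a <= 1 ->
  (map_poly red p).[red a] = red p.[a].
Proof.
move=> h a1; rewrite (horner_coef_wide _ (size_poly _ _)) horner_coef red_sum.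
  apply: eq_bigr => i _.
  by rewrite coef_red redM ?redX // (ultraX uabs) exprn_ile1 ?(ultra_ge0 uabs).
by move=> i; rewrite absvM_le1 // (ultraX uabs) exprn_ile1 ?(ultra_ge0 uabs).
Qed.

Lemma deriv_red (p : {poly L}) : (forall i, absv p`_i <= 1) ->
  (map_poly red p)^`() = map_poly red p^`().
Proof.
move=> h; apply/polyP => i; rewrite coef_deriv !coef_red coef_deriv.
rewrite -[RHS]/(red (p`_i.+1 *+ i.+1)).
elim: i.+1 (p`_i.+1) (h i.+1) => [|n IH] x x1; first by rewrite !mulr0n red0.
by rewrite !mulrS redD ?IH // -mulr_natr absvM_le1 ?absv_nat_le1.
Qed.

(** * From the reduced rational map to conditions on absolute values *)

Section GoodReductionLink.
Variables F G : {poly L}.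
Hypothesis nFG : normalized absv F G.
Hypothesis dFG : (2 <= rdeg F G)%N.
Hypothesis gFG : good_reduction red F G.
Let d := rdeg F G.
Let F' := map_poly red F.
Let G' := map_poly red G.

Let F1 i : absv F`_i <= 1. Proof. by have [h _ _] := nFG. Qed.
Let G1 i : absv G`_i <= 1. Proof. by have [_ h _] := nFG. Qed.

Let sFG : maxn (size F) (size G) = d.+1.
Proof. by rewrite prednK //; move: dFG; rewrite /rdeg; case: maxn. Qed.

Let sF : (size F <= d.+1)%N. Proof. by rewrite -sFG leq_maxl. Qed.
Let sG : (size G <= d.+1)%N. Proof. by rewrite -sFG leq_maxr. Qed.

(** Cancelling the gcd lowers the degree by the degree of the gcd, while good reduction preserves
    it. Normalization keeps the gcd nonzero. *)
Lemma gcd_red_size : size (gcdp F' G') = 1%N.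
Proof.
have D0 : gcdp F' G' != 0.
  rewrite gcdp_eq0 negb_and; have [_ _ [i hi]] := nFG.
  have nz (p : {poly L}) : absv p`_i = 1 -> map_poly red p != 0.
    move=> h; apply/eqP => e; have /esym/eqP := coef_red p i.
    by rewrite e coef0 red_eq0 h ?ltxx.
  by case: hi => /nz; [move=> -> |rewrite orbC => ->].
have sD : (0 < size (gcdp F' G'))%N by rewrite size_poly_gt0.
have key (p q : {poly k}) : (size p <= d.+1)%N -> p = q * gcdp F' G' ->
    size q = d.+1 -> size (gcdp F' G') = 1%N.
  move=> sp e sq; have q0 : q != 0 by rewrite -size_poly_eq0 sq.
  move: sp; rewrite e size_mul // sq => h.
  by apply/eqP; rewrite eqn_leq sD andbT -(leq_add2l d) addn1.
have : maxn (size (redF red F G)) (size (redG red F G)) = d.+1.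
  have := gFG; rewrite /good_reduction -/d {1}/rdeg => <-; rewrite prednK //.
  by move: gFG dFG; rewrite /good_reduction => <-; rewrite /rdeg; case: maxn.
have sF' : (size F' <= d.+1)%N by rewrite (leq_trans (size_poly _ _)).
have sG' : (size G' <= d.+1)%N by rewrite (leq_trans (size_poly _ _)).
rewrite /maxn; case: ifP => _.
  by apply: key sG' _; rewrite divpK ?dvdp_gcdr.
by apply: key sF' _; rewrite divpK ?dvdp_gcdl.
Qed.

(** The constant gcd need not be 1, so a common scalar remains. *)
Lemma redFG_scale : exists2 c, c != 0 & redF red F G = c *: F' /\ redG red F G = c *: G'.
Proof.
have /eqP/size_poly1P[c c0 e] := gcd_red_size.
by exists c^-1; rewrite ?invr_eq0 // /redF /redG e -alg_polyC !divpZr // !divp1.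
Qed.

Lemma red_top : maxn (size F') (size G') = d.+1.
Proof.
have [c c0 [eF eG]] := redFG_scale.
have := gFG; rewrite /good_reduction /rdeg eF eG !size_scale // -/F' -/G' => e.
rewrite -[LHS]prednK ?e // lt0n; apply: contraTneq dFG => z.
by rewrite /rdeg -e z.
Qed.

Lemma red_indep a b : (a != 0) || (b != 0) -> a *: F' + b *: G' != 0.
Proof.
move=> ab; apply/eqP => /(gcd_const_size gcd_red_size ab); rewrite red_top ltnS leqn0.
by move=> /eqP e; move: dFG; rewrite -/d e.
Qed.

(** Coprimality of the reductions gives [gr_fin], their top degree d gives [gr_inf], and the leading
    coefficient of a nonzero combination gives [gr_indep]. *)
Lemma good_red_of_reduction : good_red absv d F G.
Proof.
split=> //.
- move=> a a1; have cop : coprimep F' G' by rewrite /coprimep gcd_red_size.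
  have [z|nz] := eqVneq F'.[red a] 0.
    right; apply: red_neq0; first exact: absv_horner_le1 (gauss_pt_le1 absvP _) _.
    by rewrite -horner_red //; apply: coprimep_root cop _; apply/eqP.
  left; apply: red_neq0; first exact: absv_horner_le1 (gauss_pt_le1 absvP _) _.
  by rewrite -horner_red.
- have top (p : {poly L}) : size (map_poly red p) = d.+1 ->
      (forall i, absv p`_i <= 1) -> absv p`_d = 1.
    move=> sp h; apply: red_neq0; rewrite -?coef_red // -[d]/(d.+1.-1) -sp.
    by rewrite -lead_coefE lead_coef_eq0 -size_poly_eq0 sp.
  by have := red_top; rewrite /maxn; case: ifP => _ /top; [right|left]; auto.
move=> a b a1 b1 ab.
have ab' : (red a != 0) || (red b != 0).
  by rewrite !red_eq0 // -!leNgt; case: ab => ->; rewrite lexx ?orbT.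
have := red_indep ab'; rewrite -lead_coef_eq0 lead_coefE => nz.
exists (size (red a *: F' + red b *: G')).-1; apply: red_neq0.
  by rewrite (ultraD_le uabs) ?absvM_le1.
by rewrite redD ?absvM_le1 // !redM // -!coef_red -!coefZ -coefD.
Qed.

Lemma reduced_fixed_criticalP :
  (exists x : P1pt k,
       rat_map d (redF red F G) (redG red F G) x = x /\
       critical d (redF red F G) (redG red F G) x) <->
  (exists2 c, absv c <= 1 & fixed_critical_class absv F G c) \/
     fixed_critical_class absv (homrev d G) (homrev d F) 0.
Proof.
have [l l0 [-> ->]] := redFG_scale.
have G'0 : G' != 0.
  by have := @red_indep 0 1; rewrite oner_eq0 orbT scale0r add0r scale1r; apply.
have finite c : absv c <= 1 ->
    (rat_map d (l *: F') (l *: G') (Fin (red c)) = Fin (red c) /\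
       critical d (l *: F') (l *: G') (Fin (red c))) <-> fixed_critical_class absv F G c.
  (* At a fixed a the value of the map is a, so the local degree is the order of vanishing of [H] at
     a. *)
  move=> c1; set a := red c; set H := l *: (F' - a *: G').
  have H0 : H != 0.
    rewrite scaler_eq0 negb_or l0 -scaleNr -[F']scale1r.
    by apply: red_indep; rewrite oner_eq0.
  have redH (p q : {poly L}) : (forall i, absv p`_i <= 1) -> (forall i, absv q`_i <= 1) ->
      ((l *: (map_poly red p - a *: map_poly red q)).[a] == 0)
      = (absv (p.[c] - c * q.[c]) < 1).
    move=> p1 q1; have pc := absv_horner_le1 (gauss_pt_le1 absvP p1) c1.
    have qc := absv_horner_le1 (gauss_pt_le1 absvP q1) c1.
    rewrite hornerZ mulf_eq0 (negbTE l0) /= !hornerE !horner_red //.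
    rewrite -redM // -redN ?absvM_le1 // -redD ?(ultraN uabs) ?absvM_le1 //.
    by rewrite red_eq0 // (ultraB_le uabs) // absvM_le1.
  have H1 := redH _ _ F1 G1.
  have H2 := redH _ _ (gauss_deriv_le1 absvP F1) (gauss_deriv_le1 absvP G1).
  rewrite -!deriv_red // -derivZ -derivB -derivZ in H2.
  have locE : (G'.[a] != 0) -> F'.[a] = a * G'.[a] ->
      critical d (l *: F') (l *: G') (Fin a) <-> fixed_critical_class absv F G c.
    move=> Ga Fa; rewrite /critical /locdeg !hornerZ mulf_eq0 negb_or l0 Ga /= Fa.
    have -> : l * (a * G'.[a]) / (l * G'.[a]) = a by field; rewrite Ga l0.
    have -> : l *: F' - a%:P * (l *: G') = H.
      by rewrite /H scalerBr mul_polyC !scalerA [a * l]mulrC.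
    rewrite mup_geq2 // H1 H2; split=> [/andP|] [h1 h2] //; exact/andP.
  have fixE : rat_map d (l *: F') (l *: G') (Fin a) = Fin a <->
      G'.[a] != 0 /\ F'.[a] = a * G'.[a].
    rewrite /= !hornerZ mulf_eq0 negb_or l0 /=.
    have [Ga|Ga] := eqVneq G'.[a] 0; first by split=> // [[]].
    split=> [[e]|[_ ->]]; last by congr Fin; field; rewrite Ga l0.
    by split=> //; rewrite -[X in X * _]e; field; rewrite Ga l0.
  split=> [[/fixE[Ga Fa]] /(locE Ga Fa)//|crit].
  have Fa : F'.[a] = a * G'.[a].
    apply/eqP; rewrite -subr_eq0; have := crit.1; rewrite -H1.
    by rewrite hornerZ mulf_eq0 (negbTE l0) /= !hornerE.
  have Ga : G'.[a] != 0.
    have cop : coprimep F' G' by rewrite /coprimep gcd_red_size.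
    apply/negP => /eqP Ga; have Fa0 : root F' a by rewrite rootE Fa Ga mulr0.
    by have := coprimep_root cop Fa0; rewrite Ga eqxx.
  by split; [apply/fixE|apply/locE].
have sG' : (size G' <= d.+1)%N by rewrite (leq_trans (size_poly _ _)).
have infinite : (rat_map d (l *: F') (l *: G') Inf = Inf /\
       critical d (l *: F') (l *: G') Inf) <->
       fixed_critical_class absv (homrev d G) (homrev d F) 0.
  have d0 : (0 < d)%N by apply: leq_trans dFG.
  rewrite /fixed_critical_class !mul0r !subr0 horner_homrev0 deriv_homrev0 //.
  rewrite /critical /= homrevZ !hornerZ horner_homrev0 mulf_eq0 negb_or l0 /=.
  (* At infinity the local degree is the order at 0 of the reversed denominator, read off from the
     two top coefficients of G. *)
  have mupE : (2 <= mup 0 (l *: homrev d G'))%N = (absv G`_d < 1) && (absv G`_d.-1 < 1).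
    rewrite mup_geq2; last first.
      rewrite scaler_eq0 negb_or l0 /=; apply: contra_neq G'0 => z.
      by rewrite -(homrevK sG') z; apply/polyP => i; rewrite coef_homrev !coef0 if_same.
    rewrite derivZ !hornerZ !mulf_eq0 (negbTE l0) /= horner_homrev0 deriv_homrev0 //.
    by rewrite !coef_red !red_eq0.
  rewrite coef_red red_eq0 //; case: (boolP (absv G`_d < 1)) => Gd /=.
    by rewrite mupE Gd; split=> [[]|[]].
  by split=> [[]|[]].
split=> [[[a|] h]|[[c c1 /(finite c c1) h]|/infinite h]].
- have [_ _ _ _ /(_ a)[c [c1 e]]] := redP; left; exists c => //.
  by apply/finite => //; rewrite e.
- by right; apply/infinite.
- by exists (Fin (red c)).
- by exists Inf.
Qed.

End GoodReductionLink.
End Reduction.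

(** Two equivalences are joined through the existence of a fixed critical class, finite or at
    infinity. *)
Theorem theorem3p2 (R : realType) (L : closedFieldType) (absv : L -> R)
    (k : fieldType) (red : L -> k) (F G : {poly L}) :
  nonarch_abs absv -> abs_complete absv -> char0 L ->
  residue_field absv red ->
  coprimep F G -> normalized absv F G -> (2 <= rdeg F G)%N ->
  good_reduction red F G ->
  P1_connected (berk_fixed (absv := absv) F G) <->
  ~ (exists x : P1pt k,
       rat_map (rdeg (redF red F G) (redG red F G)) (redF red F G) (redG red F G) x = x /\
       critical (rdeg (redF red F G) (redG red F G)) (redF red F G) (redG red F G) x).
Proof.
move=> absvP _ _ redP _ nFG dFG gFG.
rewrite (gFG : rdeg (redF red F G) (redG red F G) = rdeg F G).
have good := good_red_of_reduction absvP redP nFG dFG gFG.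
have crit := reduced_fixed_criticalP absvP redP nFG dFG gFG.
split=> [/(connected_fixed_locusP absvP good) h /crit|h]; first exact: h.
by apply/(connected_fixed_locusP absvP good) => /crit.
Qed.
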